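(* Let $(\mathbf{K},G)$ and $(\mathbf{L},G)$ be matrix affine dynamical systems and let $f:\mathbf{L}\to\mathbf{K}$ be an equivariant continuous surjective matrix affine map. Then $((\mathbf{L},G),f)$ is a boundary for $(\mathbf{K},G)$ if and only if the corresponding extension $((A(\mathbf{L}),G),\iota)$ of $(A(\mathbf{K}),G)$ is essential, where $\iota:A(\mathbf{K})\to A(\mathbf{L})$ denotes the equivariant embedding defined by $\iota(a)(\mu)=a(f(\mu))$ for $a\in A(\mathbf{K})$ and $\mu\in\mathbf{L}$.
   Context: Matrix convexity. Let $V$ be a locally convex topological vector space. A matrix convex set is a family $\mathbf{K}=(K_n)_{n\ge1}$ of convex subsets $K_n\subseteq M_n(V)$ such that $\sum_{i=1}^k\gamma_i^*\mu_i\gamma_i\in K_n$ for all $\mu_i\in K_{n_i}$ and scalar matrices $\gamma_i\in M_{n_i,n}$ with $\sum_{i=1}^k\gamma_i^*\gamma_i=1$. It is compact if each $K_n$ is compact in the product topology on $M_n(V)$. A matrix affine map $f:\mathbf{K}\to\mathbf{L}$ is a family of maps $f_n:K_n\to L_n$ with $f_n(\sum\gamma_i^*\mu_i\gamma_i)=\sum\gamma_i^*f_{n_i}(\mu_i)\gamma_i$ for all such matrix convex combinations; continuity, surjectivity and images are understood levelwise. $A(\mathbf{K})$ is the operator system of continuous matrix affine maps from $\mathbf{K}$ to $(M_n(\mathbb{C}))_{n\ge1}$, with pointwise operations, unit the constant identity, and with an element of $M_k(A(\mathbf{K}))$ positive when its values in $M_k(M_n(\mathbb{C}))$ at all points of all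 $K_n$ are positive. Dynamics. A matrix affine dynamical system $(\mathbf{K},G,h)$ (written $(\mathbf{K},G)$) consists of a compact matrix convex set $\mathbf{K}$, a discrete group $G$ and a homomorphism $h$ from $G$ into the group of matrix affine homeomorphisms of $\mathbf{K}$ (families of homeomorphisms $K_n\to K_n$ forming a matrix affine map). $G$ acts on $A(\mathbf{K})$ by $\alpha_s(a)=a\circ h_{s^{-1}}$. A pair $((\mathbf{L},G),f)$ consisting of a matrix affine dynamical system and a continuous surjective matrix affine map $f:\mathbf{L}\to\mathbf{K}$ is a boundary for $(\mathbf{K},G)$ if whenever $\mathbf{L}'\subseteq\mathbf{L}$ is an invariant compact matrix convex subset with $f(\mathbf{L}')=\mathbf{K}$, then $\mathbf{L}'=\mathbf{L}$. Essential extensions. A noncommutative dynamical system $(S,G)$ is an operator system $S$ with an action of the discrete group $G$ by unital complete order isomorphisms. Morphisms are equivariant unital completely positive maps; an embedding is a morphism that is a complete order injection. An extension of $(S,G)$ is a pair $((T,G),\iota)$ with $\iota:S\to T$ an embedding; it is essential if whenever $\phi:T\to R$ is a morphism of noncommutative dynamical systems such that $\phi\circ\iota$ is an embedding, then $\phi$ is an embedding.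
   Formalization: The locally convex topological vector spaces containing K and L are assumed Hausdorff; without this the claim fails (e.g. V = C indiscrete, L_n = M_n(V), K_n = {0}: the extension is essential but L is not a boundary). *)

(* Defs.v *)
From HB Require Import structures.
From mathcomp Require Import all_boot all_order all_algebra.
From mathcomp Require Import complex.
From mathcomp Require Import ring.
From mathcomp Require Import all_classical all_reals all_analysis.

Set Implicit Arguments.
Unset Strict Implicit.
Unset Printing Implicit Defensive.

Import Order.TTheory GRing.Theory Num.Theory numFieldNormedType.Exports.

Local Open Scope classical_set_scope.
Local Open Scope ring_scope.
Local Open Scope sesquilinear_scope.

(* The complex numbers are [R[i]] for [R : realType]; they are written
   [R[i]^o] where they serve as a locally convex space over themselves.
   Matrix levels n >= 1 are indexed by n : nat through size n.+1. *)

Section Compression.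
Variables (R : realType) (V : lmodType R[i]).

(* g^* mu g, for a scalar matrix g and a matrix mu over V *)
Definition mxcomp m n (g : 'M[R[i]]_(m, n)) (mu : 'M[V]_m) : 'M[V]_n :=
  \matrix_(i, j) \sum_k \sum_l ((g k i)^* * g l j) *: mu k l.

End Compression.

Section MatrixConvexity.
Variable R : realType.

Definition matrix_convex (V : tvsType R[i]) (K : forall n, set 'M[V]_n.+1) :=
  (forall n (t : R[i]) (mu nu : 'M[V]_n.+1), 0 <= t -> t <= 1 ->
     K n mu -> K n nu ->
     K n (map_mx ( *:%R t) mu + map_mx ( *:%R (1 - t)) nu)) /\
  (forall n k (m : 'I_k -> nat) (mu : forall i, 'M[V]_((m i).+1))
     (g : forall i, 'M[R[i]]_((m i).+1, n.+1)),
     (forall i, K (m i) (mu i)) ->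
     \sum_i (g i)^t* *m g i = 1%:M ->
     K n (\sum_i mxcomp (g i) (mu i))).

Record cmcset (V : tvsType R[i]) := CMCSet {
  cmc_set :> forall n, set 'M[V]_n.+1;
  cmc_convex : matrix_convex cmc_set;
  cmc_compact : forall n, compact (@cmc_set n) }.
Arguments cmc_set {V} c n _.

(* A matrix affine map from K, with values regarded as matrices over W.
   The point nu is the combination of the mu i as an element of the
   subtype K n. *)
Definition matrix_affine (V : tvsType R[i]) (K : cmcset V) (W : lmodType R[i])
    (f : forall n, K n -> 'M[W]_n.+1) :=
  forall n k (m : 'I_k -> nat) (mu : forall i, K (m i))
    (g : forall i, 'M[R[i]]_((m i).+1, n.+1)) (nu : K n),
    \sum_i (g i)^t* *m g i = 1%:M ->
    val nu = \sum_i mxcomp (g i) (val (mu i)) ->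
    f n nu = \sum_i mxcomp (g i) (f (m i) (mu i)).

(* Continuous matrix affine maps K -> L; K n and L n carry the subspace
   topology. *)
Record cma_map (V W : tvsType R[i]) (K : cmcset V) (L : cmcset W) := CMAMap {
  cma_fun :> forall n, K n -> L n;
  cma_continuous : forall n, continuous (@cma_fun n);
  cma_affine : matrix_affine (fun n (x : K n) => val (@cma_fun n x)) }.
Arguments cma_fun {V W K L} c n _.

Definition cma_surjective (V W : tvsType R[i]) (K : cmcset V) (L : cmcset W)
    (f : cma_map K L) :=
  forall n (y : L n), exists x : K n, f n x = y.

Definition homeomorphic_map (X Y : topologicalType) (f : X -> Y) :=
  continuous f /\
  exists g : Y -> X, [/\ continuous g, cancel f g & cancel g f].

(* Matrix affine dynamical systems (K, G, h); the group law on matrix affine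
   homeomorphisms is composition. *)
Record mads (V : tvsType R[i]) (G : groupType) := MADS {
  mads_set :> cmcset V;
  mads_act : G -> cma_map mads_set mads_set;
  mads_homeo : forall s n, homeomorphic_map (mads_act s n);
  mads_actM : forall s t n x,
    mads_act (s * t)%g n x = mads_act s n (mads_act t n x) }.

Definition cma_equivariant (V W : tvsType R[i]) (G : groupType)
    (L : mads W G) (K : mads V G) (f : cma_map L K) :=
  forall s n (x : L n), f n (mads_act L s n x) = mads_act K s n (f n x).

(* The condition for ((L, G), f) to be a boundary for (K, G), where f is an
   equivariant surjective map of dynamical systems. *)
Definition is_boundary (V W : tvsType R[i]) (G : groupType)
    (K : mads V G) (L : mads W G) (f : cma_map L K) :=
  forall L' : cmcset W,
    (forall n, L' n `<=` L n) ->
    (forall s n (x : L n), L' n (val x) -> L' n (val (mads_act L s n x))) ->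
    (forall n, f n @` [set x : L n | L' n (val x)] = [set: K n]) ->
    forall n, L' n = L n.

End MatrixConvexity.

Section OperatorSystems.
Variable R : realType.

(* Abstract (Choi-Effros) operator systems: matrix ordered *-vector spaces
   with an Archimedean matrix order unit. The zero system is allowed. *)
Record opsys := OpSys {
  os_car :> lmodType R[i];
  os_star : os_car -> os_car;
  os_pos : forall k, set 'M[os_car]_k.+1;
  os_unit : os_car;
  os_starD : forall x y, os_star (x + y) = os_star x + os_star y;
  os_starZ : forall (c : R[i]) x, os_star (c *: x) = c^* *: os_star x;
  os_starK : forall x, os_star (os_star x) = x;
  os_star_unit : os_star os_unit = os_unit;
  os_pos_herm : forall k (a : 'M[os_car]_k.+1), os_pos a -> map_mx os_star a^T = a;
  os_posD : forall k (a b : 'M[os_car]_k.+1), os_pos a -> os_pos b -> os_pos (a + b);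
  os_posZ : forall k (t : R[i]) (a : 'M[os_car]_k.+1), 0 <= t -> os_pos a ->
    os_pos (map_mx ( *:%R t) a);
  os_pos_proper : forall k (a : 'M[os_car]_k.+1), os_pos a -> os_pos (- a) -> a = 0;
  os_pos_comp : forall k l (g : 'M[R[i]]_(k.+1, l.+1)) (a : 'M[os_car]_k.+1),
    os_pos a -> os_pos (mxcomp g a);
  os_order_unit : forall k (a : 'M[os_car]_k.+1), map_mx os_star a^T = a ->
    exists2 r : R[i], 0 < r &
      os_pos ((\matrix_(i, j) if i == j then r *: os_unit else 0) + a);
  os_archimedean : forall k (a : 'M[os_car]_k.+1), map_mx os_star a^T = a ->
    (forall r : R[i], 0 < r ->
      os_pos ((\matrix_(i, j) if i == j then r *: os_unit else 0) + a)) ->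
    os_pos a }.

Definition unital_cp (S T : opsys) (phi : {linear S -> T}) :=
  phi (os_unit S) = os_unit T /\
  forall k (a : 'M[S]_k.+1), os_pos a -> os_pos (map_mx phi a).

(* complete order isomorphism onto its range *)
Definition complete_order_injection (S T : opsys) (phi : {linear S -> T}) :=
  injective phi /\
  forall k (a : 'M[S]_k.+1), os_pos (map_mx phi a) <-> os_pos a.

Record ncsys (G : groupType) := NCSys {
  nc_sys :> opsys;
  nc_act : G -> {linear nc_sys -> nc_sys};
  nc_act_unit : forall s, nc_act s (os_unit nc_sys) = os_unit nc_sys;
  nc_act_bij : forall s, bijective (nc_act s);
  nc_act_coi : forall s, complete_order_injection (nc_act s);
  nc_actM : forall s t x, nc_act (s * t)%g x = nc_act s (nc_act t x) }.

Definition nc_morphism (G : groupType) (S T : ncsys G)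
    (phi : {linear S -> T}) :=
  unital_cp phi /\ forall s x, phi (nc_act S s x) = nc_act T s (phi x).

Definition nc_embedding (G : groupType) (S T : ncsys G)
    (phi : {linear S -> T}) :=
  nc_morphism phi /\ complete_order_injection phi.

Record nc_extension (G : groupType) (S : ncsys G) := NCExtension {
  ext_sys : ncsys G;
  ext_map : {linear S -> ext_sys};
  ext_embedding : nc_embedding ext_map }.

Definition is_essential (G : groupType) (S : ncsys G) (E : nc_extension S) :=
  forall (Q : ncsys G) (phi : {linear ext_sys E -> Q}),
    nc_morphism phi ->
    nc_embedding (phi \o ext_map E : {linear S -> Q}) ->
    nc_embedding phi.

End OperatorSystems.

(* Positivity in M_k(M_n(C)), acting on C^n (x) C^k; the columns of x are the
   k components in C^n. *)
Section BlockPositivity.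
Variable R : realType.

Definition blockform k n (A : 'M['M[R[i]^o]_n]_k) (x y : 'M[R[i]]_(n, k)) : R[i] :=
  \sum_i \sum_j ((col i x)^t* *m (A i j : 'M[R[i]]_n) *m col j y) 0 0.

Definition blockpos k n (A : 'M['M[R[i]^o]_n]_k) :=
  forall x : 'M[R[i]]_(n, k), 0 <= blockform A x x.

End BlockPositivity.

Section AffineFunctions.
Variables (R : realType) (V : tvsType R[i]) (K : cmcset V).

Record affmap := AffMap {
  aff_fun :> forall n, K n -> 'M[R[i]^o]_n.+1;
  aff_continuous : forall n, continuous (@aff_fun n);
  aff_affine : matrix_affine (@aff_fun) }.
Arguments aff_fun a n _ : clear implicits.

HB.instance Definition _ := gen_eqMixin affmap.
HB.instance Definition _ := gen_choiceMixin affmap.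

Lemma affmapP (a b : affmap) : (forall n x, a n x = b n x) -> a = b.
Proof.
case: a b => [a ca aa] [b cb ab] /= E.
have ? : a = b by apply: functional_extensionality_dep => n; apply/funext.
by subst b; congr AffMap; exact: Prop_irrelevance.
Qed.

End AffineFunctions.

Section MatrixContinuity.

Lemma mx_continuousP (X T : topologicalType) m n (f : X -> 'M[T]_(m, n)) :
  continuous f <-> forall i j, continuous (fun x => f x i j).
Proof.
split=> [cf i j x|cf x] U.
  move=> Ux; have nP : nbhs (f x) [set A : 'M[T]_(m, n) | U (A i j)].
    exists (fun i' j' => [set y | i' = i -> j' = j -> U y]); last first.
      by move=> A /(_ i j); apply.
    move=> i' j' /=; have [->|ni] := eqVneq i' i; have [->|nj] := eqVneq j' j.
    - by apply: filterS Ux => y Uy _ _.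
    - by apply: filterE => y _ /eqP; rewrite (negbTE nj).
    - by apply: filterE => y /eqP; rewrite (negbTE ni).
    - by apply: filterE => y /eqP; rewrite (negbTE ni).
  exact: (cf x _ nP).
move=> [P nP sPU].
have H : \forall y \near x, forall i j, P i j (f y i j).
  apply: filter_forall => i; apply: filter_forall => j.
  exact: (cf i j x _ (nP i j)).
by apply: filterS H => y Py; exact: sPU.
Qed.

Variables (R : realType) (X : topologicalType).

Lemma contD (f g : X -> R[i]^o) : continuous f -> continuous g ->
  continuous (fun x => f x + g x).
Proof. by move=> cf cg x; apply: cvgD; [exact: cf|exact: cg]. Qed.

Lemma contZ (c : R[i]) (f : X -> R[i]^o) : continuous f ->
  continuous (fun x => c * f x : R[i]^o).
Proof. by move=> cf x; apply: cvgMl_tmp; exact: cf. Qed.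

Lemma contJ (f : X -> R[i]^o) : continuous f ->
  continuous (fun x => (f x : R[i])^* : R[i]^o).
Proof.
move=> cf x; apply/(@cvgrPdist_lt _ R[i]^o) => e e0.
have := @cvgr_dist_lt _ R[i]^o _ (nbhs x) _ f (f x) (cf x) e e0.
move=> H; near=> y; rewrite -rmorphB norm_conjC.
by near: y; exact: H.
Unshelve. all: by end_near.
Qed.

End MatrixContinuity.

Section CompressionTheory.
Variable R : realType.
Implicit Types V W : lmodType R[i].

Lemma mxcompD V m n (g : 'M[R[i]]_(m, n)) (a b : 'M[V]_m) :
  mxcomp g (a + b) = mxcomp g a + mxcomp g b.
Proof.
apply/matrixP => i j; rewrite !mxE -big_split; apply: eq_bigr => k _.
by rewrite -big_split; apply: eq_bigr => l _; rewrite mxE scalerDr.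
Qed.

Lemma mxcompZ V m n (g : 'M[R[i]]_(m, n)) (c : R[i]) (a : 'M[V]_m) :
  mxcomp g (map_mx ( *:%R c) a) = map_mx ( *:%R c) (mxcomp g a).
Proof.
apply/matrixP => i j; rewrite !mxE scaler_sumr; apply: eq_bigr => k _.
rewrite scaler_sumr; apply: eq_bigr => l _.
by rewrite mxE !scalerA mulrC.
Qed.

Lemma mxcompE m n (g : 'M[R[i]]_(m, n)) (a : 'M[R[i]^o]_m) :
  mxcomp g a = g^t* *m (a : 'M[R[i]]_m) *m g.
Proof.
apply/matrixP => i j; rewrite !mxE exchange_big; apply: eq_bigr => l _.
rewrite !mxE mulr_suml; apply: eq_bigr => k _.
by rewrite !mxE mulrAC.
Qed.

Lemma adjmxM m n p (A : 'M[R[i]]_(m, n)) (B : 'M[R[i]]_(n, p)) :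
  (A *m B)^t* = B^t* *m A^t*.
Proof. by rewrite trmx_mul map_mxM. Qed.

Lemma mxcomp_star m n (g : 'M[R[i]]_(m, n)) (a : 'M[R[i]^o]_m) :
  (mxcomp g a : 'M[R[i]]_n)^t* = mxcomp g ((a : 'M[R[i]]_m)^t*).
Proof. by rewrite !mxcompE !adjmxM trmxCK mulmxA. Qed.

Lemma mxcomp_id V n (a : 'M[V]_n) : mxcomp 1%:M a = a.
Proof.
apply/matrixP => i j; rewrite !mxE (bigD1 i)//= (bigD1 j)//= !mxE !eqxx.
rewrite conjC1 mulr1 scale1r big1 ?addr0 => [|l nl]; last first.
  by rewrite !mxE (negbTE nl) mulr0 scale0r.
rewrite big1 ?addr0// => k nk; rewrite big1// => l _.
by rewrite !mxE (negbTE nk) conjC0 mul0r scale0r.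
Qed.

End CompressionTheory.

Section AffineFunctionSpace.
Variables (R : realType) (V : tvsType R[i]) (K : cmcset V).
Local Notation AK := (affmap K).

Lemma aff_continuous_entry (a : AK) n i j : continuous (fun x => a n x i j).
Proof. by move: i j; apply/mx_continuousP; exact: aff_continuous. Qed.

Program Definition aff_zero : AK := @AffMap R V K (fun n x => 0) _ _.
Next Obligation. by move=> n; exact: cst_continuous. Qed.
Next Obligation.
move=> n k m mu g nu _ _; rewrite big1// => i _.
by rewrite mxcompE mulmx0 mul0mx.
Qed.

Program Definition aff_add (a b : AK) : AK :=
  @AffMap R V K (fun n x => a n x + b n x) _ _.
Next Obligation.
move=> a b n; apply/mx_continuousP => i j.
under eq_fun do rewrite mxE.
by apply: contD; exact: aff_continuous_entry.
Qed.
Next Obligation.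
move=> a b n k m mu g nu g1 nuE; rewrite (aff_affine a g1 nuE).
rewrite (aff_affine b g1 nuE) -big_split; apply: eq_bigr => i _.
by rewrite mxcompD.
Qed.

Program Definition aff_scale (c : R[i]) (a : AK) : AK :=
  @AffMap R V K (fun n x => c *: a n x) _ _.
Next Obligation.
move=> c a n; apply/mx_continuousP => i j.
under eq_fun do rewrite mxE.
by apply: contZ; exact: aff_continuous_entry.
Qed.
Next Obligation.
move=> c a n k m mu g nu g1 nuE; rewrite (aff_affine a g1 nuE).
rewrite scaler_sumr; apply: eq_bigr => i _.
by rewrite !mxcompE -scalemxAr -scalemxAl.
Qed.

Program Definition aff_star (a : AK) : AK :=
  @AffMap R V K (fun n x => (a n x : 'M[R[i]]_n.+1)^t*) _ _.
Next Obligation.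
move=> a n; apply/mx_continuousP => i j.
under eq_fun do rewrite !mxE.
by apply: contJ; exact: aff_continuous_entry.
Qed.
Next Obligation.
move=> a n k m mu g nu g1 nuE; rewrite (aff_affine a g1 nuE).
rewrite !raddf_sum/=; apply: eq_bigr => i _.
by rewrite mxcomp_star.
Qed.

Program Definition aff_unit : AK := @AffMap R V K (fun n x => 1%:M) _ _.
Next Obligation. by move=> n; exact: cst_continuous. Qed.
Next Obligation.
move=> n k m mu g nu g1 _; rewrite -[LHS]g1.
by apply: eq_bigr => i _; rewrite mxcompE mulmx1.
Qed.

Lemma aff_addA : associative aff_add.
Proof. by move=> a b c; apply: affmapP => n x; exact: addrA. Qed.
Lemma aff_addC : commutative aff_add.
Proof. by move=> a b; apply: affmapP => n x; exact: addrC. Qed.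
Lemma aff_add0 : left_id aff_zero aff_add.
Proof. by move=> a; apply: affmapP => n x; exact: add0r. Qed.
Lemma aff_addN : left_inverse aff_zero (aff_scale (-1)) aff_add.
Proof. by move=> a; apply: affmapP => n x /=; rewrite scaleN1r addNr. Qed.

HB.instance Definition _ := GRing.isZmodule.Build AK
  aff_addA aff_addC aff_add0 aff_addN.

Lemma aff_scaleA (c d : R[i]) (a : AK) :
  aff_scale c (aff_scale d a) = aff_scale (c * d) a.
Proof. by apply: affmapP => n x /=; rewrite scalerA. Qed.
Lemma aff_scale1 : left_id 1 aff_scale.
Proof. by move=> a; apply: affmapP => n x /=; rewrite scale1r. Qed.
Lemma aff_scaleDr : right_distributive aff_scale +%R.
Proof. by move=> c a b; apply: affmapP => n x /=; rewrite scalerDr. Qed.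
Lemma aff_scaleDl (a : AK) : {morph aff_scale^~ a : c d / c + d}.
Proof. by move=> c d; apply: affmapP => n x /=; rewrite scalerDl. Qed.

HB.instance Definition _ := GRing.Zmodule_isLmodule.Build R[i] AK
  aff_scaleA aff_scale1 aff_scaleDr aff_scaleDl.

End AffineFunctionSpace.

Section Polarization.
Variables (C : numClosedFieldType) (X : lmodType C) (s : X -> X -> C).
Hypothesis sDl : forall x y z, s (x + y) z = s x z + s y z.
Hypothesis sDr : forall x y z, s x (y + z) = s x y + s x z.
Hypothesis sZl : forall c x y, s (c *: x) y = c^* * s x y.
Hypothesis sZr : forall c x y, s x (c *: y) = c * s x y.

Lemma sesqui_expand c x y : s (x + c *: y) (x + c *: y) =
  s x x + c * s x y + c^* * s y x + c^* * c * s y y.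
Proof. by rewrite sDl !sDr !sZl !sZr; ring. Qed.

Lemma polarization x y : 4%:R * s x y =
  s (x + 1 *: y) (x + 1 *: y) - s (x + (-1) *: y) (x + (-1) *: y)
  - 'i * s (x + 'i *: y) (x + 'i *: y)
  + 'i * s (x + (- 'i) *: y) (x + (- 'i) *: y).
Proof.
rewrite !sesqui_expand !rmorphN !rmorph1 /= !conjCi.
have ii : 'i * 'i = -1 :> C by rewrite -expr2 sqrCi.
ring: ii.
Qed.

Lemma sesqui_parallelogram x y :
  s (x + 1 *: y) (x + 1 *: y) + s (x + (-1) *: y) (x + (-1) *: y) +
  s (x + 'i *: y) (x + 'i *: y) + s (x + (- 'i) *: y) (x + (- 'i) *: y) =
  4%:R * (s x x + s y y).
Proof.
rewrite !sesqui_expand !rmorphN !rmorph1 /= !conjCi.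
have ii : 'i * 'i = -1 :> C by rewrite -expr2 sqrCi.
ring: ii.
Qed.

Lemma sesqui_eq0 : (forall x, s x x = 0) -> forall x y, s x y = 0.
Proof.
move=> s0 x y; have := polarization x y.
rewrite !s0 !mulr0 !subr0 addr0 => /eqP.
by rewrite mulf_eq0 pnatr_eq0 /= => /eqP.
Qed.

Lemma sesqui_bound (s0 : X -> C) (M : C) :
  (forall x y, s0 (x + 1 *: y) + s0 (x + (-1) *: y) +
     s0 (x + 'i *: y) + s0 (x + (- 'i) *: y) = 4%:R * (s0 x + s0 y)) ->
  (forall x, `|s x x| <= M * s0 x) ->
  forall x y, `|s x y| <= M * (s0 x + s0 y).
Proof.
move=> par bnd x y; rewrite -(ler_pM2l (_ : 0 < 4%:R)) ?ltr0n//.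
rewrite -{1}(ger0_norm (ler0n C 4)) -normrM polarization.
rewrite mulrCA -par !mulrDr.
apply: le_trans (ler_normD _ _) _; apply: lerD; last first.
  by rewrite normrM normCi mul1r.
apply: le_trans (ler_normB _ _) _; apply: lerD; last first.
  by rewrite normrM normCi mul1r.
by apply: le_trans (ler_normB _ _) _; apply: lerD.
Qed.

End Polarization.

Section BlockTheory.
Variable R : realType.
Local Notation C := (R[i]).

Definition cform n (A : 'M[C]_n) (x y : 'cV[C]_n) : C := (x^t* *m A *m y) 0 0.

Lemma adjmxD m n (x y : 'M[C]_(m, n)) : (x + y)^t* = x^t* + y^t*.
Proof. by rewrite linearD map_mxD. Qed.

Lemma adjmxZ m n (c : C) (x : 'M[C]_(m, n)) : (c *: x)^t* = c^* *: x^t*.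
Proof. by rewrite linearZ map_mxZ. Qed.

Lemma cformDl n A (x y z : 'cV_n) : cform A (x + y) z = cform A x z + cform A y z.
Proof. by rewrite /cform adjmxD !mulmxDl mxE. Qed.
Lemma cformDr n A (x y z : 'cV_n) : cform A x (y + z) = cform A x y + cform A x z.
Proof. by rewrite /cform !mulmxDr mxE. Qed.
Lemma cformZl n A c (x y : 'cV_n) : cform A (c *: x) y = c^* * cform A x y.
Proof. by rewrite /cform adjmxZ -!scalemxAl mxE. Qed.
Lemma cformZr n A c (x y : 'cV_n) : cform A x (c *: y) = c * cform A x y.
Proof. by rewrite /cform -!scalemxAr mxE. Qed.
Lemma cformDm n A B (x y : 'cV_n) : cform (A + B) x y = cform A x y + cform B x y.
Proof. by rewrite /cform mulmxDr mulmxDl mxE. Qed.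
Lemma cformZm n c A (x y : 'cV_n) : cform (c *: A) x y = c * cform A x y.
Proof. by rewrite /cform -scalemxAr -scalemxAl mxE. Qed.
Lemma cform0m n (x y : 'cV_n) : cform 0 x y = 0.
Proof. by rewrite /cform mulmx0 mul0mx mxE. Qed.

Lemma conj_cform n A (x y : 'cV_n) : (cform A x y)^* = cform (A^t*) y x.
Proof.
transitivity (((x^t* *m A *m y)^t*) 0 0); first by rewrite [RHS]mxE [in RHS]mxE.
by rewrite adjmxM adjmxM trmxCK mulmxA.
Qed.

Lemma cform1E n (x : 'cV_n) : cform 1%:M x x = \sum_i `|x i 0| ^+ 2.
Proof.
rewrite /cform mulmx1 mxE; apply: eq_bigr => i _.
by rewrite !mxE normCKC.
Qed.

Lemma cform1_ge0 n (x : 'cV_n) : 0 <= cform 1%:M x x.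
Proof. by rewrite cform1E; apply: sumr_ge0 => i _; rewrite exprn_ge0. Qed.

Lemma cform1_eq0 n (x : 'cV_n) : cform 1%:M x x = 0 -> x = 0.
Proof.
rewrite cform1E => /eqP; rewrite psumr_eq0 => [/allP H|i _]; last first.
  by rewrite exprn_ge0.
apply/matrixP => i j; rewrite ord1 mxE; have := H i (mem_index_enum _).
by rewrite sqrf_eq0 normr_eq0 => /eqP.
Qed.

Lemma cform_bound n (A : 'M[C]_n) (M : C) :
  (forall x, `|cform A x x| <= M * cform 1%:M x x) ->
  forall x y, `|cform A x y| <= M * (cform 1%:M x x + cform 1%:M y y).
Proof.
apply: (sesqui_bound (@cformDl n A) (@cformDr n A) (@cformZl n A) (@cformZr n A)
  (s0 := fun x => cform 1%:M x x)) => x y.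
exact: (sesqui_parallelogram (@cformDl n _) (@cformDr n _) (@cformZl n _) (@cformZr n _)).
Qed.

Variables (n k : nat).
Implicit Types (A B : 'M['M[R[i]^o]_n]_k) (x y z : 'M[C]_(n, k)).

Lemma blockformE A x y :
  blockform A x y = \sum_i \sum_j cform (A i j) (col i x) (col j y).
Proof. by []. Qed.

Lemma blockformDl A x y z : blockform A (x + y) z = blockform A x z + blockform A y z.
Proof.
rewrite !blockformE -big_split; apply: eq_bigr => i _; rewrite -big_split.
by apply: eq_bigr => j _; rewrite linearD cformDl.
Qed.
Lemma blockformDr A x y z : blockform A x (y + z) = blockform A x y + blockform A x z.
Proof.
rewrite !blockformE -big_split; apply: eq_bigr => i _; rewrite -big_split.
by apply: eq_bigr => j _; rewrite linearD cformDr.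
Qed.
Lemma blockformZl A c x y : blockform A (c *: x) y = c^* * blockform A x y.
Proof.
rewrite !blockformE mulr_sumr; apply: eq_bigr => i _; rewrite mulr_sumr.
by apply: eq_bigr => j _; rewrite linearZ cformZl.
Qed.
Lemma blockformZr A c x y : blockform A x (c *: y) = c * blockform A x y.
Proof.
rewrite !blockformE mulr_sumr; apply: eq_bigr => i _; rewrite mulr_sumr.
by apply: eq_bigr => j _; rewrite linearZ cformZr.
Qed.
Lemma blockformDm A B x y : blockform (A + B) x y = blockform A x y + blockform B x y.
Proof.
rewrite !blockformE -big_split; apply: eq_bigr => i _; rewrite -big_split.
by apply: eq_bigr => j _; rewrite mxE cformDm.
Qed.

Lemma blockformNm A x y : blockform (- A) x y = - blockform A x y.
Proof.
rewrite !blockformE -sumrN; apply: eq_bigr => i _; rewrite -sumrN.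
by apply: eq_bigr => j _; rewrite mxE -scaleN1r cformZm mulN1r.
Qed.

Definition blockadj A : 'M['M[R[i]^o]_n]_k :=
  \matrix_(i, j) (A j i : 'M[C]_n)^t*.

Lemma conj_blockform A x y : (blockform A x y)^* = blockform (blockadj A) y x.
Proof.
rewrite !blockformE exchange_big rmorph_sum; apply: eq_bigr => i _ /=.
by rewrite rmorph_sum; apply: eq_bigr => j _ /=; rewrite conj_cform mxE.
Qed.

Lemma blockform_delta A i j p q :
  blockform A (delta_mx p i) (delta_mx q j) = A i j p q.
Proof.
rewrite blockformE (bigD1 i)//= (bigD1 j)//=.
have col0 p' i' i0 : i0 != i' -> col i0 (delta_mx p' i' : 'M[C]_(n, k)) = 0.
  by move=> ni; apply/matrixP => u v; rewrite !mxE (negbTE ni) andbF.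
have col1 p' i' : col i' (delta_mx p' i' : 'M[C]_(n, k)) = delta_mx p' 0.
  by apply/matrixP => u v; rewrite !mxE !eqxx ord1 eqxx.
rewrite !big1 ?addr0; first last.
- by move=> j' nj; rewrite (col0 _ j)// /cform mulmx0 mxE.
- move=> i' ni; rewrite big1// => j' _.
  by rewrite (col0 _ i)// /cform linear0 map_mx0 !mul0mx mxE.
rewrite !col1 /cform trmx_delta map_delta_mx.
by rewrite -rowE -colE !mxE.
Qed.

Lemma blockform_eq0 A : (forall x, blockform A x x = 0) -> A = 0.
Proof.
move=> A0; apply/matrixP => i j; apply/matrixP => p q.
rewrite -blockform_delta (sesqui_eq0 (blockformDl A) (blockformDr A)
  (blockformZl A) (blockformZr A))//.
by rewrite !mxE.
Qed.

Lemma blockpos_herm A : blockpos A -> blockadj A = A.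
Proof.
move=> posA; apply/eqP; rewrite -subr_eq0; apply/eqP/blockform_eq0 => x.
rewrite blockformDm -conj_blockform blockformNm.
by rewrite geC0_conj ?subrr//; exact: posA.
Qed.

End BlockTheory.

Section AffineOperatorSystem.
Variables (R : realType) (V : tvsType R[i]) (K : cmcset V).
Local Notation AK := (affmap K).
Local Notation C := (R[i]).

Lemma affDE (a b : AK) n x : (a + b) n x = a n x + b n x.
Proof. by []. Qed.
Lemma affNE (a : AK) n x : (- a) n x = - a n x.
Proof. by rewrite -[RHS]scaleN1r. Qed.
Lemma affZE (c : C) (a : AK) n x : (c *: a) n x = c *: a n x.
Proof. by []. Qed.
Lemma aff_sumE I (r : seq I) (F : I -> AK) n x :
  (\sum_(i <- r) F i) n x = \sum_(i <- r) F i n x.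
Proof. by elim/big_rec2: _ => // i _ b _ <-. Qed.

(* The value at x of a in M_k(A(K)), as an element of M_k(M_n(C)). *)
Definition affmx_eval k (a : 'M[AK]_k) n (x : K n) : 'M['M[R[i]^o]_n.+1]_k :=
  \matrix_(i, j) a i j n x.

Definition affpos k : set 'M[AK]_k.+1 :=
  [set a | forall n (x : K n), blockpos (affmx_eval a x)].

Lemma aff_bounded (a : AK) :
  exists2 M : C, 0 < M & forall x : K 0%N, `|a 0%N x 0 0| <= M.
Proof.
have [M /= M0 HM] : exists2 M : R, 0 < M &
    forall v, K 0%N v -> forall x : K 0%N, val x = v -> `|a 0%N x 0 0| <= M%:C%C.
  have /compact_near_coveringP/(_ R (pinfty_nbhs R)
    (fun M v => forall x : K 0%N, val x = v -> `|a 0%N x 0 0| <= M%:C%C) _) := @cmc_compact _ _ K 0%N.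
  case=> [v Kv|M [_ H]]; last first.
    exists (Num.max M 0 + 1).
      by rewrite ltr_wpDl// le_max lexx orbT.
    by apply: H; rewrite ltr_pwDr// le_max lexx.
  pose x0 : K 0%N := exist _ v (mem_set Kv).
  have ca : continuous (fun x : K 0%N => a 0%N x 0 0 : R[i]^o).
    exact: (proj1 (mx_continuousP _) (@aff_continuous _ _ _ a 0%N) 0 0).
  have := @cvgr_dist_lt _ R[i]^o _ _ _ _ _ (ca x0) 1 ltr01.
  case => _ [] [W oW <-] /= Wx0 HW.
  exists (W, [set M | complex.Re `|a 0%N x0 0 0| + 1 < M]) => /=.
    split; first by apply: open_nbhs_nbhs.
    by apply: nbhs_pinfty_gt; rewrite num_real.
  move=> [w M] [/= Ww HM] x xw.
  have /HW /= H : (set_val @^-1` W) x by rewrite -xw in Ww; exact: Ww.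
  have -> : a 0%N x 0 0 = a 0%N x0 0 0 - (a 0%N x0 0 0 - a 0%N x 0 0).
    by rewrite opprB addrC subrK.
  apply: le_trans (ler_normB _ _) _.
  apply: (@le_trans _ _ ((complex.Re `|a 0%N x0 0 0| + 1)%:C%C)); last first.
    by rewrite lecR ltW.
  rewrite rmorphD rmorph1; apply: lerD; last exact: ltW.
  by rewrite [X in _ <= X]RRe_real ?normr_real.
exists M%:C%C; first by rewrite ltcR.
move=> x; apply: (HM (val x)) => //.
exact: set_valP.
Qed.
Lemma aff_cform_level1 (a : AK) n (x : K n) (xi : 'cV[C]_n.+1) :
  xi^t* *m xi = 1%:M -> exists y : K 0%N, cform (a n x) xi xi = a 0%N y 0 0.
Proof.
move=> xi1.
have Ky : K 0%N (\sum_(i < 1) mxcomp xi (val x)).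
  apply: (@cmc_convex _ _ K).2 => [_|]; last by rewrite big_ord1.
  exact: set_valP.
pose y : K 0%N := exist (fun v => v \in K 0%N) _ (mem_set Ky); exists y.
have := @aff_affine _ _ _ a 0%N 1 (fun=> n) (fun=> x) (fun=> xi) y.
rewrite !big_ord1 => -> //; last by rewrite /= big_ord1.
by rewrite mxcompE.
Qed.

Lemma aff_cform_bounded (a : AK) :
  exists2 M : C, 0 < M & forall n (x : K n) xi zeta,
    `|cform (a n x) xi zeta| <= M * (cform 1%:M xi xi + cform 1%:M zeta zeta).
Proof.
have [M M0 HM] := aff_bounded a; exists M => // n x; apply: cform_bound => xi.
have [->|xi0] := eqVneq xi 0.
  by rewrite /cform !mulmx0 !mxE normr0 mulr0.
set t := cform 1%:M xi xi.
have t0 : 0 < t.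
  rewrite lt_neqAle cform1_ge0 andbT eq_sym.
  by apply: contra_neq xi0; exact: cform1_eq0.
have st0 : 0 < sqrtC t by rewrite sqrtC_gt0.
pose eta := (sqrtC t)^-1 *: xi.
have xiE : xi = sqrtC t *: eta by rewrite scalerA divff ?gt_eqF// scale1r.
have stJ : (sqrtC t)^* = sqrtC t by rewrite geC0_conj// ltW.
have sVJ : ((sqrtC t)^-1)^* = (sqrtC t)^-1 by rewrite geC0_conj// invr_ge0 ltW.
have [] := @aff_cform_level1 a n x eta.
  apply/matrixP => i j; rewrite !ord1 [RHS]mxE eqxx.
  have -> : (eta^t* *m eta) 0 0 = cform 1%:M eta eta by rewrite /cform mulmx1.
  rewrite cformZl cformZr sVJ mulrA -invfM -expr2 sqrtCK -/t.
  by rewrite mulVf ?gt_eqF.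
move=> y yE; rewrite [in X in X <= _]xiE cformZl cformZr yE stJ mulrA -expr2 sqrtCK.
by rewrite normrM (gtr0_norm t0) mulrC ler_wpM2r// ltW.
Qed.

Lemma affmx_blockform_bounded k (a : 'M[AK]_k) :
  exists2 M : C, 0 < M & forall n (x : K n) (z : 'M[C]_(n.+1, k)),
    `|blockform (affmx_eval a x) z z| <= M * \sum_i cform 1%:M (col i z) (col i z).
Proof.
pose Mf i j := projT1 (cid2 (aff_cform_bounded (a i j))).
have Mf0 i j : 0 < Mf i j by rewrite /Mf; case: cid2.
have MfP i j n (x : K n) xi zeta : `|cform (a i j n x) xi zeta| <=
    Mf i j * (cform 1%:M xi xi + cform 1%:M zeta zeta).
  by rewrite /Mf; case: cid2 => /= M _; apply.
pose S := \sum_i \sum_j Mf i j.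
have S0 : 0 <= S by apply: sumr_ge0 => i _; apply: sumr_ge0 => j _; exact: ltW.
exists (S *+ 2 + 1); first by rewrite ltr_wpDl// mulrn_wge0.
move=> n x z; set N := \sum_i _.
have N0 : 0 <= N by apply: sumr_ge0 => i _; exact: cform1_ge0.
have NN i : cform 1%:M (col i z) (col i z) <= N.
  rewrite /N (bigD1 i)//= lerDl; apply: sumr_ge0 => j _; exact: cform1_ge0.
apply: (@le_trans _ _ (S *+ 2 * N)); last by rewrite ler_wpM2r// lerDl.
rewrite blockformE -mulr_natr -mulrA mulr_suml.
apply: le_trans (ler_norm_sum _ _ _) _; apply: ler_sum => i _.
rewrite mulr_suml.
apply: le_trans (ler_norm_sum _ _ _) _; apply: ler_sum => j _.
rewrite mxE; apply: le_trans (MfP i j n x _ _) _.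
apply: ler_wpM2l; first exact: ltW.
by rewrite mulr_natl mulr2n lerD.
Qed.

Lemma affmx_evalD k (a b : 'M[AK]_k) n (x : K n) :
  affmx_eval (a + b) x = affmx_eval a x + affmx_eval b x.
Proof. by apply/matrixP => i j; rewrite !mxE. Qed.

Lemma affmx_evalN k (a : 'M[AK]_k) n (x : K n) :
  affmx_eval (- a) x = - affmx_eval a x.
Proof. by apply/matrixP => i j; rewrite !mxE affNE. Qed.

Lemma affmx_eval_star k (a : 'M[AK]_k) n (x : K n) :
  affmx_eval (map_mx (@aff_star R V K) a^T) x = blockadj (affmx_eval a x).
Proof. by apply/matrixP => i j; rewrite !mxE. Qed.

Lemma affmx_evalP k (a b : 'M[AK]_k) :
  (forall n (x : K n), affmx_eval a x = affmx_eval b x) -> a = b.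
Proof.
move=> H; apply/matrixP => i j; apply: affmapP => n x.
by have /matrixP/(_ i j) := H n x; rewrite !mxE.
Qed.

Lemma affpos_herm k (a : 'M[AK]_k.+1) : affpos a ->
  map_mx (@aff_star R V K) a^T = a.
Proof.
move=> pa; apply: affmx_evalP => n x.
by rewrite affmx_eval_star; exact/blockpos_herm/pa.
Qed.

Lemma affposD k (a b : 'M[AK]_k.+1) : affpos a -> affpos b -> affpos (a + b).
Proof.
by move=> pa pb n x z; rewrite affmx_evalD blockformDm addr_ge0 ?pa ?pb.
Qed.

Lemma affposZ k (t : C) (a : 'M[AK]_k.+1) : 0 <= t -> affpos a ->
  affpos (map_mx ( *:%R t) a).
Proof.
move=> t0 pa n x z.
suff -> : blockform (affmx_eval (map_mx ( *:%R t) a) x) z z =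
    t * blockform (affmx_eval a x) z z by rewrite mulr_ge0// pa.
rewrite !blockformE mulr_sumr; apply: eq_bigr => i _; rewrite mulr_sumr.
by apply: eq_bigr => j _; rewrite !mxE affZE cformZm.
Qed.

Lemma affpos_proper k (a : 'M[AK]_k.+1) : affpos a -> affpos (- a) -> a = 0.
Proof.
move=> pa na; apply: affmx_evalP => n x.
transitivity (0 : 'M['M[R[i]^o]_n.+1]_k.+1); last first.
  by apply/matrixP => i j; rewrite !mxE.
apply: blockform_eq0 => z; apply/eqP; rewrite eq_le pa andbT -oppr_ge0.
by rewrite -blockformNm -affmx_evalN na.
Qed.

Lemma cform_sumr n (A : 'M[C]_n) x I (r : seq I) F :
  cform A x (\sum_(i <- r) F i) = \sum_(i <- r) cform A x (F i).
Proof.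
apply: (big_morph _ (cformDr A x)).
by rewrite -(scale0r 0) cformZr mul0r.
Qed.

Lemma cform_suml n (A : 'M[C]_n) y I (r : seq I) F :
  cform A (\sum_(i <- r) F i) y = \sum_(i <- r) cform A (F i) y.
Proof.
apply: (big_morph (fun x => cform A x y) (fun u v => cformDl A u v y)).
by rewrite -(scale0r 0) cformZl conjC0 mul0r.
Qed.

Lemma cform_summ n (x y : 'cV[C]_n) I (r : seq I) (F : I -> 'M[R[i]^o]_n) :
  cform (\sum_(i <- r) F i) x y = \sum_(i <- r) cform (F i) x y.
Proof.
apply: (big_morph (fun A => cform A x y) (fun A B => cformDm A B x y)).
exact: cform0m.
Qed.

Lemma affpos_comp k l (g : 'M[C]_(k.+1, l.+1)) (a : 'M[AK]_k.+1) :
  affpos a -> affpos (mxcomp g a).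
Proof.
move=> pa n x z.
suff -> : blockform (affmx_eval (mxcomp g a) x) z z =
    blockform (affmx_eval a x) (z *m g^T) (z *m g^T) by exact: pa.
have colE i : col i (z *m g^T) = \sum_j g i j *: col j z.
  apply/matrixP => p q; rewrite !mxE summxE; apply: eq_bigr => j _.
  by rewrite !mxE mulrC.
pose F i j p q := (g p i)^* * g q j * cform (a p q n x) (col i z) (col j z).
transitivity (\sum_i \sum_j \sum_p \sum_q F i j p q).
  rewrite blockformE; apply: eq_bigr => i _; apply: eq_bigr => j _.
  rewrite !mxE aff_sumE cform_summ; apply: eq_bigr => p _.
  rewrite aff_sumE cform_summ; apply: eq_bigr => q _.
  by rewrite affZE cformZm.
transitivity (\sum_p \sum_q \sum_i \sum_j F i j p q).
  under eq_bigr do rewrite exchange_big.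
  rewrite exchange_big; apply: eq_bigr => p _ /=.
  under eq_bigr do rewrite exchange_big.
  by rewrite exchange_big.
rewrite blockformE; apply: eq_bigr => p _; apply: eq_bigr => q _.
rewrite !colE cform_suml; apply: eq_bigr => i _.
rewrite cformZl cform_sumr mulr_sumr; apply: eq_bigr => j _.
by rewrite cformZr mxE mulrA.
Qed.

Definition aff_order_unit k (r : C) : 'M[AK]_k :=
  \matrix_(i, j) if i == j then r *: aff_unit K else 0.

Lemma blockform_unit k (r : C) n (x : K n) (z : 'M[C]_(n.+1, k)) :
  blockform (affmx_eval (aff_order_unit k r) x) z z =
  r * \sum_i cform 1%:M (col i z) (col i z).
Proof.
rewrite blockformE mulr_sumr; apply: eq_bigr => i _.
rewrite (bigD1 i)//= big1 ?addr0 => [|j ji].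
  by rewrite !mxE eqxx affZE cformZm.
by rewrite !mxE eq_sym (negbTE ji) cform0m.
Qed.

Lemma blockform_herm_real k (a : 'M[AK]_k) n (x : K n) (z : 'M[C]_(n.+1, k)) :
  map_mx (@aff_star R V K) a^T = a ->
  blockform (affmx_eval a x) z z \is Num.real.
Proof.
by move=> ha; rewrite CrealE conj_blockform -affmx_eval_star ha.
Qed.

Lemma aff_unitP k (a : 'M[AK]_k.+1) : map_mx (@aff_star R V K) a^T = a ->
  exists2 r : C, 0 < r & affpos (aff_order_unit k.+1 r + a).
Proof.
move=> ha; have [M M0 HM] := affmx_blockform_bounded a; exists M => // n x z.
rewrite affmx_evalD blockformDm blockform_unit.
by rewrite -lerBlDl sub0r lerNl; have := HM n x z;
  rewrite real_ler_norml ?blockform_herm_real// => /andP[+ _]; rewrite lerNl.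
Qed.

Lemma aff_archimedean k (a : 'M[AK]_k.+1) : map_mx (@aff_star R V K) a^T = a ->
  (forall r : C, 0 < r -> affpos (aff_order_unit k.+1 r + a)) -> affpos a.
Proof.
move=> ha Ha n x z; set N := \sum_i cform 1%:M (col i z) (col i z).
have N0 : 0 <= N by apply: sumr_ge0 => i _; exact: cform1_ge0.
have ar := blockform_herm_real x z ha.
rewrite real_leNgt ?real0//; apply/negP => bz.
have rN : 0 < N + 1 by rewrite ltr_wpDl.
have r0 : 0 < - blockform (affmx_eval a x) z z / (N + 1).
  by rewrite divr_gt0// oppr_gt0.
have := Ha _ r0 n x z; rewrite affmx_evalD blockformDm blockform_unit -/N.
apply/negP; rewrite -real_ltNge ?real0//; last first.
  by apply: realD => //; apply: realM; [exact: gtr0_real|exact: ger0_real].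
rewrite -ltrBrDr sub0r -mulrA gtr_pMr ?oppr_gt0//.
by rewrite mulrC ltr_pdivrMr// mul1r ltrDl.
Qed.

Lemma aff_starD (a b : AK) : aff_star (a + b) = aff_star a + aff_star b.
Proof. by apply: affmapP => n x; exact: adjmxD. Qed.
Lemma aff_starZ (c : C) (a : AK) : aff_star (c *: a) = c^* *: aff_star a.
Proof. by apply: affmapP => n x; exact: adjmxZ. Qed.
Lemma aff_starK (a : AK) : aff_star (aff_star a) = a.
Proof. by apply: affmapP => n x; exact: trmxCK. Qed.
Lemma aff_star_unit : aff_star (aff_unit K) = aff_unit K.
Proof. by apply: affmapP => n x; rewrite /= trmx1 map_mx1. Qed.

Definition affsys : opsys R := @OpSys R AK (@aff_star R V K) affpos (aff_unit K)
  aff_starD aff_starZ aff_starK aff_star_unit affpos_herm affposD affposZ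
  affpos_proper affpos_comp aff_unitP aff_archimedean.

End AffineOperatorSystem.

Section AffinePullback.
Variables (R : realType) (V W : tvsType R[i]) (L : cmcset W) (K : cmcset V).
Variable f : cma_map L K.

Program Definition aff_pull (a : affmap K) : affmap L :=
  @AffMap R W L (fun n x => a n (f n x)) _ _.
Next Obligation.
move=> a n x; apply: (@continuous_comp _ _ _ (f n) (a n)).
  exact: cma_continuous.
exact: aff_continuous.
Qed.
Next Obligation.
move=> a n k m mu g nu g1 nuE.
apply: (aff_affine a g1).
exact: (@cma_affine _ _ _ _ _ f n k m mu g nu g1 nuE).
Qed.

Lemma aff_pull_linear : linear aff_pull.
Proof. by move=> c a b; apply: affmapP. Qed.

HB.instance Definition _ :=
  GRing.isLinear.Build R[i] (affmap K) (affmap L) _ aff_pull aff_pull_linear.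

Lemma affmx_eval_pull k (a : 'M[affmap K]_k) n (x : L n) :
  affmx_eval (map_mx aff_pull a) x = affmx_eval a (f n x).
Proof. by apply/matrixP => i j; rewrite !mxE. Qed.

Definition aff_precomp : {linear affsys K -> affsys L} := aff_pull.

Lemma aff_precomp_ucp : unital_cp aff_precomp.
Proof.
split; first by apply: affmapP.
by move=> k a pa n x; rewrite affmx_eval_pull; exact: pa.
Qed.

Hypothesis fsurj : cma_surjective f.

Lemma aff_precomp_inj : complete_order_injection aff_precomp.
Proof.
split=> [a b ab|k a]; last split=> pa n x.
- apply: affmapP => n y; have [x <-] := fsurj y.
  by have := congr1 (fun c : affmap L => c n x) ab.
- by have [y <-] := fsurj x; rewrite -affmx_eval_pull; exact: pa.
- by rewrite affmx_eval_pull; exact: pa.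
Qed.

End AffinePullback.

Section AffineDynamics.
Variables (R : realType) (G : groupType).

Section Action.
Variables (V : tvsType R[i]) (K : mads V G).

Lemma mads_act1 n (x : K n) : mads_act K 1%g n x = x.
Proof.
have [_ [g [_ fg _]]] := @mads_homeo _ _ _ K 1%g n.
by apply: (can_inj fg); rewrite -mads_actM mulg1.
Qed.

Lemma mads_act_surj s : cma_surjective (mads_act K s).
Proof. by move=> n y; exists (mads_act K s^-1%g n y); rewrite -mads_actM mulgV mads_act1. Qed.

Definition aff_act (s : G) : {linear affsys K -> affsys K} :=
  aff_precomp (mads_act K s^-1%g).

Lemma aff_act_unit s : aff_act s (os_unit (affsys K)) = os_unit (affsys K).
Proof. by have [] := aff_precomp_ucp (mads_act K s^-1%g). Qed.

Lemma aff_actM s t x : aff_act (s * t)%g x = aff_act s (aff_act t x).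
Proof. by apply: affmapP => n y /=; rewrite invgM mads_actM. Qed.

Lemma aff_act_bij s : bijective (aff_act s).
Proof.
exists (aff_act s^-1%g) => a; apply: affmapP => n y /=;
  by rewrite -mads_actM ?mulgV ?mulVg mads_act1.
Qed.

Lemma aff_act_coi s : complete_order_injection (aff_act s).
Proof. exact/aff_precomp_inj/mads_act_surj. Qed.

Definition aff_ncsys : ncsys R G :=
  @NCSys R G (affsys K) aff_act aff_act_unit aff_act_bij aff_act_coi aff_actM.

End Action.

Section Extension.
Variables (V W : tvsType R[i]) (K : mads V G) (L : mads W G).
Variables (f : cma_map L K) (feq : cma_equivariant f) (fsurj : cma_surjective f).

Lemma aff_precomp_embedding :
  nc_embedding (aff_precomp f : {linear aff_ncsys K -> aff_ncsys L}).
Proof.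
split; last exact: aff_precomp_inj.
split; first exact: aff_precomp_ucp.
by move=> s a; apply: affmapP => n x /=; rewrite feq.
Qed.

Definition aff_extension : nc_extension (aff_ncsys K) :=
  NCExtension aff_precomp_embedding.

End Extension.

End AffineDynamics.

(* Main.v *)
Require Import Defs.
From HB Require Import structures.
From mathcomp Require Import all_boot all_order all_algebra.
From mathcomp Require Import complex.
From mathcomp Require Import ring lra.
From mathcomp Require Import all_classical all_reals all_analysis.

Set Implicit Arguments.
Unset Strict Implicit.
Unset Printing Implicit Defensive.

Import Order.TTheory GRing.Theory Num.Theory numFieldNormedType.Exports.

Local Open Scope classical_set_scope.
Local Open Scope ring_scope.
Local Open Scope sesquilinear_scope.
Local Open Scope complex_scope.

(** The points of a compact matrix convex set [M] are exactly the matrix states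
    of [A(M)]: a matrix state that is not a point evaluation would be separated
    from them, on finitely many functions and up to a small error, by a state of
    a suitable cone, and compactness removes the error.  This is used twice.
    If the extension is essential and [L'] is invariant with [f(L') = K], then
    restriction from [A(L)] to [A(L')] is an embedding on [A(K)], hence on
    [A(L)]; so evaluation at a point of [L] is a matrix state of [A(L')], that
    is, a point of [L'].
    Conversely, given [phi] on [A(L)] that is an embedding on [A(K)], the points
    at which every element made positive by [phi] is positive form an invariant
    compact matrix convex subset of [L].  It maps onto [K]: evaluation at a point
    of [K] extends to a matrix state of [A(L)] that is positive for [phi], and
    this extension is evaluation at a point of [L].  Hence it is all of [L],
    which says that [phi] is an embedding. *)

(** * Real functionals on convex cones, by Zorn's lemma *)

Section ConeState.
Variables (R : realType) (E : lmodType R[i]).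

Definition real_linear (F : E -> R) :=
  forall (t : R) x y, F (t%:C *: x + y) = t * F x + F y.

Section RealLinear.
Variables (F : E -> R) (lF : real_linear F).

Lemma real_linearD x y : F (x + y) = F x + F y.
Proof. by rewrite -{1}[x]scale1r lF mul1r. Qed.

Lemma real_linear0 : F 0 = 0.
Proof. by apply: (addrI (F 0)); rewrite -real_linearD !addr0. Qed.

Lemma real_linearZ t x : F (t%:C *: x) = t * F x.
Proof. by rewrite -[_ *: _]addr0 lF real_linear0 addr0. Qed.

Lemma real_linearN x : F (- x) = - F x.
Proof. by apply: (addrI (F x)); rewrite -real_linearD !subrr real_linear0. Qed.

Lemma real_linear_sum I (r : seq I) (P : pred I) (x : I -> E) :
  F (\sum_(i <- r | P i) x i) = \sum_(i <- r | P i) F (x i).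
Proof. exact: (big_morph F real_linearD real_linear0). Qed.

End RealLinear.

(** This is the only complex linear functional with real part [F]; linearity over the complex
    numbers rests on [F (i (i x)) = - F x]. *)
Lemma real_linear_complexify (F : E -> R) : real_linear F ->
  exists phi : {linear E -> R[i]^o}, forall x, phi x = F x +i* (- F ('i%C *: x)).
Proof.
move=> lF; pose phi x : R[i]^o := F x +i* (- F ('i%C *: x)).
have Fi t x : F (t *: x) = complex.Re t * F x + complex.Im t * F ('i%C *: x).
  rewrite {1}[t]complexE mulrC scalerDl (real_linearD lF) -scalerA.
  by rewrite !(real_linearZ lF).
have lphi : linear phi.
  move=> c x y; have iE : 'i%C *: (c *: x + y) = c *: ('i%C *: x) + 'i%C *: y.
    by rewrite scalerDr !scalerA mulrC.
  rewrite /phi iE !(real_linearD lF) !(Fi c) scalerA -expr2 sqr_i scaleN1r.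
  rewrite (real_linearN lF) /GRing.scale/=.
  by case: c {iE} => a b; apply/eqP; rewrite eq_complex /=; apply/andP;
    split; apply/eqP; ring.
pose Phi : {linear E -> R[i]^o} :=
  HB.pack phi (GRing.isLinear.Build R[i] E R[i]^o _ phi lphi).
by exists Phi.
Qed.

Definition convex_cone (D : set E) :=
  [/\ D 0, forall x y, D x -> D y -> D (x + y) &
    forall (t : R) x, 0 <= t -> D x -> D (t%:C *: x)].

(** If a cone maximal among those avoiding [w] contained neither [x] nor [- x], then [w = m + t x]
    and [w = n - s x] with [m], [n] in the cone and [s, t > 0]; hence [(s + t) w = s m + t n] would
    lie in the cone. *)
Lemma maximal_cone (D : set E) (w : E) : convex_cone D -> ~ D w ->
  exists M : set E, [/\ D `<=` M, convex_cone M, ~ M w &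
    forall x, M x \/ M (- x)].
Proof.
move=> cD wD.
(* [D] is adjoined to [M] so that the empty chain, whose union is empty, also satisfies [P]. *)
pose P M := convex_cone (D `|` M) /\ ~ (D `|` M) w.
have [F FP tF|M [[cM wM] maxM]] := @Zorn_bigcup E P.
  have [D0 DD DZ] := cD.
  split; last first.
    by case=> // -[X FX Xw]; have [_] := FP _ FX; apply; right.
  have wit x : (D `|` \bigcup_(X in F) X) x -> D x \/ exists2 X, F X & X x.
    by case=> [|[X FX Xx]]; [left|right; exists X].
  split=> [|x y /wit Hx /wit Hy|t x t0 /wit]; first by left.
    have two X : F X -> (D `|` X) x -> (D `|` X) y ->
        (D `|` \bigcup_(X in F) X) (x + y).
      move=> FX Xx Xy; have [[_ H _] _] := FP _ FX.
      by have [|?] := H x y Xx Xy; [left|right; exists X].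
    case: Hx => [Dx|[X FX Xx]]; case: Hy => [Dy|[Y FY Yy]].
    - by left; exact: DD.
    - by apply: (two Y); [|left|right].
    - by apply: (two X); [|right|left].
    - have [XY|YX] := tF _ _ FX FY.
        by apply: (two Y) => //; right => //; exact: XY.
      by apply: (two X) => //; right => //; exact: YX.
  case=> [Dx|[X FX Xx]]; first by left; exact: DZ.
  have [[_ _ H] _] := FP _ FX.
  by have [|?] := H t x t0 (or_intror Xx); [left|right; exists X].
pose N := D `|` M; have [N0 ND NZ] := cM.
have grow x : ~ N x -> exists2 t : R, 0 < t & exists2 m, N m & w = m + t%:C *: x.
  move=> Nx; apply: contrapT => nex.
  pose B : set E := [set y | exists2 t : R, 0 <= t & exists2 m, N m & y = m + t%:C *: x].
  have NB : N `<=` B by move=> y Ny; exists 0 => //; exists y; rewrite // scale0r addr0.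
  have DB : D `|` B = B.
    by apply/seteqP; split=> y; [case=> // Dy; apply: NB; left|right].
  apply: (maxM B).
    split=> [y My|BM]; first by apply: NB; right.
    apply: Nx; right; apply: BM.
    by exists 1 => //; exists 0; rewrite // add0r scale1r.
  rewrite /P DB; split; last first.
    move=> [t t0 [m Nm wE]]; move: t0; rewrite le_eqVlt => /predU1P[t0|t0].
      by apply: wM; rewrite wE -t0 scale0r addr0.
    by apply: nex; exists t => //; exists m.
  split=> [|_ _ [s s0 [m Nm ->]] [t t0 [n Nn ->]]|t _ t0 [s s0 [m Nm ->]]].
  - exact: NB.
  - exists (s + t); first exact: addr_ge0.
    by exists (m + n); [exact: ND|rewrite rmorphD scalerDl addrACA].
  - exists (t * s); first exact: mulr_ge0.
    by exists (t%:C *: m); [exact: NZ|rewrite rmorphM scalerDr scalerA].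
exists N; split => // [x|x]; first by left.
apply: contrapT => /not_orP[/grow[t t0 [m Nm wm]] /grow[s s0 [n Nn wn]]].
apply: wM; rewrite -/N.
have st0 : s + t != 0 by rewrite gt_eqF// addr_gt0.
have -> : w = ((s + t)^-1)%:C *: (s%:C *: m + t%:C *: n).
  have -> : s%:C *: m + t%:C *: n = (s + t)%:C *: w.
    rewrite rmorphD scalerDl {1}wm wn !scalerDr !scalerA mulrC scalerN.
    by rewrite addrACA subrr addr0.
  by rewrite scalerA -rmorphM mulVf// scale1r.
apply: (NZ); first by rewrite invr_ge0 ltW// addr_gt0.
by apply: ND; apply: NZ => //; exact: ltW.
Qed.

(* The functional is the gauge [sup {r | x - r e \in M}] of a maximal cone [M]
   containing [D] but not [w]; such a cone is total. *)
Lemma cone_state (D : set E) (e w : E) : convex_cone D ->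
  (forall x, exists2 t : R, 0 <= t & D (t%:C *: e + x)) -> ~ D w ->
  exists F : E -> R, [/\ real_linear F, forall x, D x -> 0 <= F x, F e = 1 &
    F w <= 0].
Proof.
move=> cD eD wD; have [M [DM [M0 MD MZ] wM tot]] := maximal_cone cD wD.
have eM x : exists2 t : R, 0 <= t & M (t%:C *: e + x).
  by have [t t0 /DM] := eD x; exists t.
(* A negative multiple of [e] in [M] would cancel the [t e] in [t e + w] and put [w] in [M]. *)
have Ne (r : R) : M (r%:C *: e) -> 0 <= r.
  move=> Mr; rewrite leNgt; apply/negP => r0; apply: wM.
  have [t t0 Mt] := eM w.
  have -> : w = (t%:C *: e + w) + (- t / r)%:C *: (r%:C *: e).
    rewrite scalerA -rmorphM divfK ?lt_eqF// rmorphN scaleNr.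
    by rewrite addrAC subrr add0r.
  apply: MD => //; apply: MZ => //.
  by rewrite mulr_le0 ?oppr_le0// invr_le0 ltW.
have Pe (r : R) : 0 <= r -> M (r%:C *: e).
  move=> r0; have [|] := tot e; first exact: MZ.
  by rewrite -scaleN1r -(rmorphN1 (real_complex R)) => /Ne; rewrite oppr_ge0 ler10.
pose S x := [set r : R | M (x - r%:C *: e)].
pose F x := sup (S x).
have S0 x : S x !=set0.
  by have [t _ Mt] := eM x; exists (- t); rewrite /S/= rmorphN scaleNr opprK addrC.
have Sub x r t : S x r -> M (t%:C *: e - x) -> r <= t.
  move=> Sr Mt; rewrite -subr_ge0; apply: Ne.
  by have := MD _ _ Mt Sr; rewrite addrA subrK rmorphB scalerBl.
have hS x : has_sup (S x).
  split; first exact: S0.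
  have [t _ Mt] := eM (- x); exists t => r Sr; exact: Sub Sr Mt.
have ltF x r : r < F x -> M (x - r%:C *: e).
  rewrite -subr_gt0 => /sup_adherent/(_ (hS x))[s Ss].
  rewrite opprB addrC subrK => /ltW rs.
  have -> : x - r%:C *: e = (x - s%:C *: e) + (s - r)%:C *: e.
    by rewrite rmorphB scalerBl addrA subrK.
  by apply: MD => //; apply: Pe; rewrite subr_ge0.
(* Above the supremum [x - r e] is not in [M], so by totality its opposite is. *)
have gtF x r : F x < r -> M (r%:C *: e - x).
  move=> Fr; have [Mx|] := tot (x - r%:C *: e); last by rewrite opprB.
  by move: Fr; rewrite ltNge => /negP; case; exact: sup_upper_bound.
have geF x r : M (x - r%:C *: e) -> r <= F x by move=> ?; exact: sup_upper_bound.
have leF x r : M (r%:C *: e - x) -> F x <= r.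
  by move=> Mr; apply: sup_le_ub => // s Ss; exact: Sub Ss Mr.
have FD x y : F (x + y) = F x + F y.
  apply/eqP; rewrite eq_le; apply/andP; split; apply/ler_addgt0Pr => d d0.
    have -> : F x + F y + d = (F x + d / 2) + (F y + d / 2) by lra.
    apply: leF; rewrite rmorphD scalerDl opprD addrACA.
    by apply: MD; apply: gtF; rewrite ltrDl divr_gt0.
  rewrite -lerBlDr.
  have -> : F x + F y - d = (F x - d / 2) + (F y - d / 2) by lra.
  apply: geF; rewrite rmorphD scalerDl opprD addrACA.
  by apply: MD; apply: ltF; rewrite ltrBlDr ltrDl divr_gt0.
have F0 : F 0 = 0 by apply: (addrI (F 0)); rewrite -FD !addr0.
have FN x : F (- x) = - F x.
  by apply: (addrI (F x)); rewrite -FD !subrr F0.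
have FZp (t : R) x : 0 < t -> F (t%:C *: x) <= t * F x.
  move=> t0; apply/ler_addgt0Pr => d d0.
  apply: leF.
  have -> : t * F x + d = t * (F x + d / t).
    by rewrite mulrDr [d / t]mulrC mulrA divff ?mul1r// gt_eqF.
  rewrite rmorphM -scalerA -scalerBr; apply: MZ; first exact: ltW.
  by apply: gtF; rewrite ltrDl divr_gt0.
have FZ (t : R) x : F (t%:C *: x) = t * F x.
  have pos (s : R) : 0 < s -> F (s%:C *: x) = s * F x.
    move=> s0; apply/eqP; rewrite eq_le FZp//= -lerN2 -FN -scalerN -mulrN -FN.
    exact: FZp.
  have [t0|t0|->] := ltgtP t 0; last by rewrite scale0r F0 mul0r.
    have := pos (- t); rewrite oppr_gt0 rmorphN scaleNr FN mulNr => /(_ t0).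
    exact: oppr_inj.
  exact: pos.
exists F; split.
- by move=> t x y; rewrite FD FZ.
- by move=> x Dx; apply: geF; rewrite scale0r subr0; exact: DM.
- apply/eqP; rewrite eq_le; apply/andP; split; [apply: leF|apply: geF];
    by rewrite scale1r subrr.
(* Since [w] is not in [M], totality gives [- w] in [M]. *)
- apply: leF; rewrite scale0r sub0r.
  by have [|] := tot w.
Qed.

End ConeState.

(** * Hahn-Banach separation in a Hausdorff locally convex space *)

Section DualSeparation.
Variables (R : realType) (V : tvsType R[i]).
Local Notation C := R[i].

Lemma convex_nbhs0_avoid (v : V) : hausdorff_space V -> v != 0 ->
  exists U : set V, [/\ nbhs 0 U, ~ U v &
    forall (t : R) x y, 0 <= t <= 1 -> U x -> U y ->
      U (t%:C *: x + (1 - t)%:C *: y)].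
Proof.
move=> hV v0; have [B cB [Bo bB]] := @locally_convex _ V.
have [|A [oA A0 Av]] := hausdorff_accessible hV (x := 0) (y := v).
  by rewrite eq_sym.
have /bB [U [BU U0] UA] : nbhs (0 : V) A.
  by apply: open_nbhs_nbhs; split=> //; exact: set_mem.
exists U; split.
- by apply: open_nbhs_nbhs; split=> //; exact: Bo.
- by move: Av; rewrite inE => Av /UA.
- move=> t x y /andP[t0 t1] Ux Uy.
  have t0' : 0 <= t%:C by rewrite ler0c.
  have t1' : t%:C <= 1 by rewrite -[1]/(1%:C) lecR.
  have := cB U (mem_set BU) x y (Itv01 t0' t1') (mem_set Ux) (mem_set Uy).
  by move=> /set_mem; rewrite /conv /= /unstable.onem rmorphB.
Qed.

(** A lower bound on [U] bounds [F] from both sides on the intersection of [U] and [- U], and this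
    intersection is then scaled by [e]. *)
Lemma real_linear_continuous (F : V -> R) (U : set V) : real_linear F ->
  nbhs 0 U -> (forall u, U u -> -1 <= F u) ->
  forall e : R, 0 < e -> nbhs (0 : V) [set u | `|F u| <= e].
Proof.
move=> lF U0 FU e e0.
have ne : e%:C != 0 :> C by rewrite gt_eqF// ltcR.
have eU := nbhs0Z ne U0.
apply: filterS (filterI eU (nbhs0N eU)) => _ [[u Uu <-] [_ [u' Uu' <-] uu']] /=.
have key w : U w -> - e <= F (e%:C *: w).
  by move=> Uw; rewrite (real_linearZ lF) -mulrN1 ler_pM2l// FU.
rewrite ler_norml key//= -lerN2 -(real_linearN lF).
by rewrite -uu' opprK key.
Qed.

(** Take a convex neighbourhood [U] of [0] without [- v], and the cone [D] spanned by [v + U]. A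
    state of [D] with value [1] at [v] is at least [-1] on [U], hence continuous, and its
    complexification does not vanish at [v]. *)
Lemma dual_separates (v : V) : hausdorff_space V -> v != 0 ->
  exists phi : {linear V -> C^o}, continuous (phi : V -> C^o) /\ phi v != 0.
Proof.
move=> hV v0; have [|U [U0 Uv cU]] := @convex_nbhs0_avoid (- v) hV.
  by rewrite oppr_eq0.
have U00 : U 0 by exact: nbhs_singleton.
pose D := [set x : V | exists2 s : R, 0 <= s & exists2 u, U u & x = s%:C *: (v + u)].
have cD : convex_cone D.
  split=> [|_ _ [s s0 [u Uu ->]] [t t0 [w Uw ->]]|t _ t0 [s s0 [u Uu ->]]].
  - by exists 0 => //; exists 0; rewrite // scale0r.
  - have := addr_ge0 s0 t0; rewrite le_eqVlt eq_sym => /predU1P[|] st.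
      have s00 : s = 0 by lra.
      have t00 : t = 0 by lra.
      by exists 0 => //; exists 0; rewrite // s00 t00 !scale0r addr0.
    exists (s + t); first exact: addr_ge0.
    exists ((s / (s + t))%:C *: u + (1 - s / (s + t))%:C *: w).
      apply: cU => //; rewrite divr_ge0 ?(ltW st)//=.
      by rewrite ler_pdivrMr// mul1r lerDl.
    rewrite !scalerDr !scalerA -!rmorphM.
    have -> : (s + t) * (s / (s + t)) = s by rewrite mulrC divfK// gt_eqF.
    have -> : (s + t) * (1 - s / (s + t)) = t.
      by rewrite mulrBr mulrC mul1r [X in _ - X]mulrC divfK ?gt_eqF// addrC addKr.
    by rewrite rmorphD scalerDl addrACA.
  - exists (t * s); first exact: mulr_ge0.
    by exists u => //; rewrite scalerA rmorphM.
(* By continuity of scaling at [0], [r x] lies in [U] for some [r > 0], and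
   [r^-1 v + x = r^-1 (v + r x)]. *)
have vD x : exists2 t : R, 0 <= t & D (t%:C *: v + x).
  have : nbhs ((0 : C) *: x) U by rewrite scale0r.
  move=> /(@scale_continuous _ V (0, x) U) [[B1 B2] /= [/nbhs_ballP[e /= e0 B1e] B2x] BU].
  have eE : e = (complex.Re e)%:C by rewrite RRe_real// gtr0_real.
  have r0 : 0 < complex.Re e / 2 by rewrite divr_gt0// -ltcR -eE.
  set r := complex.Re e / 2 in r0.
  have Ur : U (r%:C *: x).
    apply: (BU (r%:C, x)); split => /=; last exact: nbhs_singleton.
    apply: B1e; rewrite -ball_normE /= sub0r normrN gtr0_norm ?ltcR//.
    by rewrite eE ltcR /r ltr_pdivrMr// mulr_natr mulr2n ltrDl -ltcR -eE.
  exists r^-1; first by rewrite invr_ge0 ltW.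
  exists r^-1; first by rewrite invr_ge0 ltW.
  exists (r%:C *: x) => //.
  by rewrite scalerDr scalerA -rmorphM mulVf ?gt_eqF// scale1r.
have wD : ~ D (- v).
  move=> [s s0 [u Uu vE]]; apply: Uv.
  have s1 : 0 < 1 + s by rewrite ltr_pwDl.
  have -> : - v = (s / (1 + s))%:C *: u + (1 - s / (1 + s))%:C *: 0.
    rewrite scaler0 addr0.
    have : (1 + s)%:C *: - v = s%:C *: u.
      by rewrite rmorphD scalerDl scale1r {1}vE scalerDr addrAC scalerN subrr add0r.
    move=> /(congr1 ( *:%R ((1 + s)^-1)%:C)); rewrite !scalerA -!rmorphM.
    by rewrite mulVf ?gt_eqF// scale1r [_ * s]mulrC.
  apply: cU => //; rewrite divr_ge0 ?(ltW s1)//=.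
  by rewrite ler_pdivrMr// mul1r lerDr.
have [F [lF FD Fv _]] := cone_state cD vD wD.
have FU u : U u -> -1 <= F u.
  move=> Uu; have : D (v + u) by exists 1 => //; exists u; rewrite // scale1r.
  by move=> /FD; rewrite (real_linearD lF) Fv -lerBlDl sub0r.
have [phi phiE] := real_linear_complexify lF.
exists phi; split; last by rewrite phiE eq_complex/= Fv oner_eq0.
move=> x; apply/cvgrPdist_le => /= e e0.
have eE : e = (complex.Re e)%:C by rewrite RRe_real// gtr0_real.
have d0 : 0 < complex.Re e / 2 by rewrite divr_gt0// -ltcR -eE.
have nF := real_linear_continuous lF U0 FU d0.
have ni : - 'i%C != 0 :> C by rewrite oppr_eq0 eq_complex/= oner_eq0 andbF.
(* Writing [u = - i u'] gives [i u = u'], so the real and imaginary parts of [phi u] are [F u] and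
   [- F u'], each bounded by half of [e]. *)
apply: filterS (nbhsT x (filterI nF (nbhs0Z ni nF))) => _ [u [/= Fu [u' Fu' uE]] <-].
rewrite raddfD /= opprD addrA subrr sub0r normrN.
have {uE}-> : phi u = (F u)%:C - 'i%C * (F u')%:C.
  rewrite phiE -{2}uE scalerA mulrN -expr2 sqr_i opprK scale1r.
  by rewrite [LHS]complexE /= rmorphN mulrN.
apply: le_trans (ler_normD _ _) _; rewrite eE [complex.Re e]splitr rmorphD.
have nR (r : R) : `|r%:C| = `|r|%:C :> C.
  by rewrite normc_def /= expr0n addr0 sqrtr_sqr.
apply: lerD; first by rewrite nR lecR.
have -> : `|- ('i%C * (F u')%:C)| = `|(F u')%:C| :> C.
  by rewrite normrN normrM complexiE normCi mul1r.
by rewrite nR lecR.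
Qed.

End DualSeparation.

(** * Continuous matrix affine functions separate points *)

Section AffineSeparation.
Variables (R : realType) (V : tvsType R[i]) (K : cmcset V).
Local Notation C := R[i].

Lemma map_mxcomp (U W : lmodType C) (phi : {linear U -> W}) m n
    (g : 'M[C]_(m, n)) (a : 'M[U]_m) :
  map_mx phi (mxcomp g a) = mxcomp g (map_mx phi a).
Proof.
apply/matrixP => i j; rewrite !mxE linear_sum; apply: eq_bigr => k _.
by rewrite linear_sum; apply: eq_bigr => l _; rewrite linearZ !mxE.
Qed.

Lemma set_val_entry_continuous n i j : continuous (fun x : K n => val x i j).
Proof.
move: i j; apply/mx_continuousP.
exact: (@initial_continuous (K n) 'M[V]_n.+1 set_val).
Qed.

Section DualMap.
Variables (phi : {linear V -> C^o}) (cphi : continuous (phi : V -> C^o)).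

Program Definition aff_dual : affmap K :=
  @AffMap R V K (fun n x => map_mx phi (val x)) _ _.
Next Obligation.
move=> n; apply/mx_continuousP => i j; under eq_fun do rewrite mxE.
move=> x; apply: (@continuous_comp _ _ _ (fun x : K n => val x i j) phi).
  exact: set_val_entry_continuous.
exact: cphi.
Qed.
Next Obligation.
move=> n k m mu g nu g1 ->; rewrite raddf_sum; apply: eq_bigr => i _.
exact: map_mxcomp.
Qed.

End DualMap.

(** A functional separating two differing entries becomes an element of A(K) when applied
    entrywise. *)
Lemma aff_separates n (x y : K n) : hausdorff_space V ->
  (forall a : affmap K, a n x = a n y) -> x = y.
Proof.
move=> hV axy; apply/val_inj/matrixP => i j; apply/eqP; rewrite -subr_eq0.
apply: contraT => vne; have [phi [cphi /eqP[]]] := dual_separates hV vne.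
rewrite raddfB; apply/eqP; rewrite subr_eq0; apply/eqP.
by have /matrixP/(_ i j) := axy (aff_dual cphi); rewrite !mxE.
Qed.

End AffineSeparation.

(** * Hermitian matrices and functionals on finite coordinate spaces *)

Section FiniteDimension.
Variable R : realType.
Local Notation C := R[i].

(** With [c] the sum of the absolute values of the eigenvalues, [c + H] has nonnegative spectrum;
    [Y] is the square root of its diagonal form times the diagonalizing unitary. *)
Lemma hermitian_shift_sqr n (H : 'M[C]_n) : H^t* = H ->
  exists2 c : R, 0 <= c & exists Y : 'M[C]_n, c%:C%:M + H = Y^t* *m Y.
Proof.
move=> hH; have Hherm : H \is hermsymmx.
  by apply/is_hermitianmxP; rewrite expr0 scale1r hH.
have Hr := hermitian_spectral_diag_real Hherm.
have /hermitian_normalmx/orthomx_spectralP HE := Hherm.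
have PU := spectral_unitarymx H.
move: HE Hr PU; set P := spectralmx H; set sp := spectral_diag H.
move=> HE /mxOverP Hr PU; have PP : P^t* *m P = 1%:M.
  by rewrite -invmx_unitary// mulVmx// unitarymx_unit.
pose c : C := \sum_i `|sp 0 i|.
have c0 : 0 <= c by apply: sumr_ge0.
have csp i : 0 <= c + sp 0 i.
  rewrite -lerBlDr sub0r; apply: (@le_trans _ _ `|sp 0 i|).
    by rewrite -normrN; apply: real_ler_norm; rewrite realN Hr.
  by rewrite /c (bigD1 i)//= lerDl; apply: sumr_ge0.
exists (complex.Re c); first by rewrite -ler0c RRe_real// ger0_real.
exists (diag_mx (\row_i sqrtC (c + sp 0 i)) *m P).
rewrite adjmxM mulmxA -[_ *m _ *m diag_mx _]mulmxA.
have -> : (diag_mx (\row_i sqrtC (c + sp 0 i)))^t* *m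
    diag_mx (\row_i sqrtC (c + sp 0 i)) = c%:M + diag_mx sp.
  rewrite tr_diag_mx map_diag_mx mulmx_diag -diag_const_mx -linearD /=.
  congr diag_mx; apply/rowP => i; rewrite !mxE.
  by rewrite geC0_conj ?sqrtC_ge0// -expr2 sqrtCK.
rewrite mulmxDr mulmxDl RRe_real ?ger0_real// mul_mx_scalar -scalemxAl PP.
by rewrite scalemx1 [in LHS]HE invmx_unitary.
Qed.

Lemma real_linear_ffunE (I : finType) (F : {ffun I -> C^o} -> R) : real_linear F ->
  exists c : I -> C, forall v : {ffun I -> C^o}, F v = complex.Re (\sum_i c i * v i).
Proof.
move=> lF; pose d i : {ffun I -> C^o} := [ffun j => (j == i)%:R].
exists (fun i => F (d i) +i* (- F ('i%C *: d i))) => v.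
have vE : v = \sum_i ((complex.Re (v i))%:C *: d i +
                      (complex.Im (v i))%:C *: ('i%C *: d i)).
  apply/ffunP => j; rewrite sum_ffunE (bigD1 j)//= big1 => [|i ij].
    rewrite addr0 !ffunE eqxx /GRing.scale/= !mulr1 [LHS]complexE.
    by rewrite [_ * 'i%C]mulrC.
  by rewrite !ffunE eq_sym (negbTE ij) !scaler0 addr0.
rewrite {1}vE (real_linear_sum lF) raddf_sum; apply: eq_bigr => i _ /=.
rewrite (real_linearD lF) !(real_linearZ lF).
by case: (v i) => a b /=; ring.
Qed.

End FiniteDimension.

(** * Compact sets as compact subtypes *)

Section SubtypeCompact.

Lemma compact_subtypeT (X : topologicalType) (A : set X) :
  compact A -> compact [set: A].
Proof.
move=> cA F FF _; have FA : (set_val @ F) A by apply: (@filterE _ F) => x; exact: set_valP.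
have [p [Ap clp]] := cA _ _ FA.
exists (exist _ p (mem_set Ap)); split=> // B U FB [_ [[W oW <-] /= Wp WU]].
have FBv : (set_val @ F) (set_val @` B).
  by apply: (@filterS _ F _ B) => // x Bx; exists x.
have [_ [[b Bb <-] Wb]] := clp _ _ FBv (open_nbhs_nbhs (conj oW Wp)).
by exists b; split=> //; exact: WU.
Qed.

End SubtypeCompact.

(** * Compressions of affine functions and matrix convex combinations *)

Section Corners.
Variables (R : realType) (V : tvsType R[i]) (M : cmcset V) (N : nat).
Local Notation C := R[i].
Local Notation corner := {m : nat & (M m * 'M[C]_(m.+1, N))%type}.

(** A corner is a point [x] with a rectangular matrix [z], and its value is [z^* a(x) z]. Finite
    sums of such values are matrix convex combinations without the normalization, and so form a
    cone. *)
Definition corner_eval (a : affmap M) (p : corner) : 'M[C]_N :=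
  (tagged p).2^t* *m (a _ (tagged p).1 : 'M[C]_((tag p).+1)) *m (tagged p).2.

Definition corner_scale (c : C) (p : corner) : corner :=
  Tagged (fun m => (M m * 'M[C]_(m.+1, N))%type) ((tagged p).1, c *: (tagged p).2).

Lemma corner_evalZ a (t : C) p : 0 <= t ->
  corner_eval a (corner_scale (sqrtC t) p) = t *: corner_eval a p.
Proof.
move=> t0; rewrite /corner_eval/= adjmxZ geC0_conj ?sqrtC_ge0//.
by rewrite -!scalemxAl -scalemxAr scalerA -expr2 sqrtCK.
Qed.

Lemma corner_eval_linear p : linear (corner_eval ^~ p).
Proof.
move=> c a b; rewrite /corner_eval affDE affZE mulmxDr mulmxDl.
by rewrite -scalemxAr -scalemxAl.
Qed.

(** A linear map [h] into matrices of size [N] corresponds to the functional sending [b] to the sum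
    of the entries [h (b i j) i j]. Under this correspondence the compression by [z] is the block
    form at [z]. *)
Lemma corner_eval_blockform (b : 'M[affmap M]_N) m (x : M m) (z : 'M[C]_(m.+1, N)) :
  blockform (affmx_eval b x) z z =
  \sum_i \sum_j corner_eval (b i j)
    (Tagged (fun m => (M m * 'M[C]_(m.+1, N))%type) (x, z)) i j.
Proof.
rewrite blockformE; apply: eq_bigr => i _; apply: eq_bigr => j _.
rewrite mxE /corner_eval /cform /=.
rewrite [RHS]mxE mxE; apply: eq_bigr => k _; rewrite !mxE; congr (_ * _).
by apply: eq_bigr => l _; rewrite !mxE.
Qed.

Lemma corner_trace_ge0 p : 0 <= \tr (corner_eval (aff_unit M) p).
Proof.
rewrite /corner_eval mulmx1; apply: sumr_ge0 => i _.
rewrite mxE; apply: sumr_ge0 => k _.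
by rewrite !mxE -normCKC exprn_ge0.
Qed.

End Corners.

Lemma corner_combination (R : realType) (V : tvsType R[i]) (M : cmcset V) n
    (s : seq {m : nat & (M m * 'M[R[i]]_(m.+1, n.+1))%type}) :
  \sum_(p <- s) corner_eval (aff_unit M) p = 1%:M ->
  exists x : M n, forall a : affmap M, a n x = \sum_(p <- s) corner_eval a p.
Proof.
move=> s1; pose P i := tnth (in_tuple s) i.
pose mu i : M (tag (P i)) := (tagged (P i)).1.
pose g i := (tagged (P i)).2.
have g1 : \sum_i (g i)^t* *m g i = 1%:M.
  rewrite -s1 (big_tnth _ _ s); apply: eq_bigr => i _.
  by rewrite /corner_eval mulmx1.
have Mx : M n (\sum_i mxcomp (g i) (val (mu i))).
  by apply: (@cmc_convex _ _ M).2 => // i; exact: set_valP.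
pose x : M n := exist _ (\sum_i mxcomp (g i) (val (mu i))) (mem_set Mx).
exists x => a; rewrite (aff_affine a (nu := x) g1 erefl) (big_tnth _ _ s).
by apply: eq_bigr => i _; rewrite mxcompE.
Qed.

Lemma ler_sum_term (C : numDomainType) (I : finType) (h : I -> C) i :
  (forall i, 0 <= h i) -> h i <= \sum_i h i.
Proof. by move=> h0; rewrite (bigD1 i) // lerDl; apply: sumr_ge0. Qed.

Lemma ler_sum3_term (C : numDomainType) (I J K : finType) (h : I -> J -> K -> C) i j k :
  (forall i j k, 0 <= h i j k) -> h i j k <= \sum_i \sum_j \sum_k h i j k.
Proof.
move=> h0; have h1 i' j' : 0 <= \sum_k h i' j' k by apply: sumr_ge0.
apply: (le_trans (ler_sum_term k (h0 i j))).
apply: (le_trans (ler_sum_term j (h1 i))).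
by apply: (ler_sum_term i) => i'; apply: sumr_ge0.
Qed.

(** * Matrix states are point evaluations *)

Section MatrixState.
Variables (R : realType) (V : tvsType R[i]) (M : cmcset V).
Local Notation C := R[i].
Variables (J : lmodType C) (alpha : {linear J -> affmap M}) (n : nat).
Variables (psi : {linear J -> 'M[C]_n.+1}) (e : J) (x0 : M n).
Hypotheses (alpha_e : alpha e = aff_unit M) (psi_e : psi e = 1%:M).
(** Complete positivity of a map into matrices of size [n.+1] is tested on the single associated
    functional, at that same matrix size. Real parts allow [b] to be any matrix rather than a
    self-adjoint one. *)
Hypothesis psi_pos : forall b : 'M[J]_n.+1,
  (forall m (x : M m) (z : 'M[C]_(m.+1, n.+1)),
    0 <= complex.Re (blockform (affmx_eval (map_mx alpha b) x) z z)) ->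
  0 <= complex.Re (\sum_i \sum_j psi (b i j) i j).

Local Notation corner := {m : nat & (M m * 'M[C]_(m.+1, n.+1))%type}.

Section FiniteFamily.
Variables (r : nat) (a : 'I_r -> J) (delta : R).
Hypothesis delta0 : 0 < delta.

Local Notation I := (option 'I_r * 'I_n.+1 * 'I_n.+1)%type.
Local Notation E := {ffun I -> C^o}.

Let aa (o : option 'I_r) := if o is Some l then a l else e.

Let datum (h : J -> 'M[C]_n.+1) : E := [ffun i => h (aa i.1.1) i.1.2 i.2].

Let mass (s : seq corner) : C := \sum_(p <- s) \tr (corner_eval (aff_unit M) p).

(* Only the Hermitian part of the [None] block is constrained, so that the
   datum at [x0] is an order unit of the whole real space. *)
Let tube : set E := [set v | exists s : seq corner,
  (forall l i j, `|v (Some l, i, j) - \sum_(p <- s) corner_eval (alpha (a l)) p i j|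
     <= delta%:C * mass s) /\
  forall i j, v (None, i, j) + (v (None, j, i))^*%R =
    2 * \sum_(p <- s) corner_eval (aff_unit M) p i j].

Let tube_cone : convex_cone tube.
Proof.
split=> [|v w [s [vs vs']] [t [wt wt']]|t v t0 [s [vs vs']]].
- exists [::]; split=> [l i j|i j].
    by rewrite ffunE /mass !big_nil subr0 normr0 mulr0.
  by rewrite !ffunE big_nil rmorph0 addr0 mulr0.
- exists (s ++ t); split=> [l i j|i j].
    rewrite !ffunE /mass !big_cat /= mulrDr opprD addrACA.
    by apply: le_trans (ler_normD _ _) _; apply: lerD.
  by rewrite !ffunE rmorphD big_cat /= mulrDr -vs' -wt' addrACA.
- have t0' : 0 <= t%:C :> C by rewrite ler0c.
  have tE b i j : \sum_(p <- map (corner_scale (sqrtC t%:C)) s) corner_eval b p i j =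
      t%:C * \sum_(p <- s) corner_eval b p i j.
    by rewrite big_map mulr_sumr; apply: eq_bigr => p _; rewrite corner_evalZ// mxE.
  exists (map (corner_scale (sqrtC t%:C)) s); split=> [l i j|i j].
    rewrite !ffunE tE -mulrBr normrM ger0_norm//.
    have -> : mass (map (corner_scale (sqrtC t%:C)) s) = t%:C * mass s.
      rewrite /mass big_map mulr_sumr; apply: eq_bigr => p _.
      by rewrite corner_evalZ// linearZ.
    by rewrite mulrCA ler_wpM2l.
  rewrite !ffunE tE mulrCA -vs' mulrDr /GRing.scale/= rmorphM.
  by rewrite /= (geC0_conj t0').
Qed.

Let ev0 : E := datum (fun b => alpha b n x0).

Let at0 (z : 'M[C]_n.+1) : corner :=
  Tagged (fun m => (M m * 'M[C]_(m.+1, n.+1))%type) (x0, z).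

(** The corner [Y] at [x0] realizes the Hermitian part of the [None] block after a shift by [c]. The
    error this leaves in the other blocks is at most [b], and adding the multiple [b / delta] of the
    identity corner at [x0] creates enough mass for the tolerance to absorb it. *)
Let tube_order_unit v : exists2 t : R, 0 <= t & tube (t%:C *: ev0 + v).
Proof.
pose H : 'M[C]_n.+1 := \matrix_(i, j) ((v (None, i, j) + (v (None, j, i))^*%R) / 2).
have [|c c0 [Y HY]] := @hermitian_shift_sqr _ _ H.
  apply/matrixP => i j; rewrite !mxE rmorphM rmorphD /= conjCK addrC.
  by rewrite (@geC0_conj _ 2^-1) ?invr_ge0 ?ler0n.
pose err l i j := v (Some l, i, j) + c%:C * alpha (a l) n x0 i j -
  corner_eval (alpha (a l)) (at0 Y) i j.
pose B : C := \sum_l \sum_i \sum_j `|err l i j|.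
have B0 : 0 <= B by do 3![apply: sumr_ge0 => ? _].
have errB l i j : `|err l i j| <= B by apply: (ler_sum3_term (h := fun l i j => `|err l i j|)).
pose b := complex.Re B.
have bE : b%:C = B by rewrite RRe_real// ger0_real.
have b0 : 0 <= b by rewrite -ler0c bE.
pose s := [:: at0 (sqrtC (b / delta)%:C *: 1%:M); at0 Y].
have bd0 : 0 <= (b / delta)%:C :> C by rewrite ler0c divr_ge0// ltW.
have at1 f : corner_eval f (at0 (sqrtC (b / delta)%:C *: 1%:M)) =
    (b / delta)%:C *: (f n x0 : 'M[C]_n.+1).
  rewrite -[at0 _]/(corner_scale _ (at0 1%:M)) corner_evalZ//.
  by rewrite /corner_eval /= mulmx1 trmx1 map_mx1 mul1mx.
exists (c + b / delta); first by rewrite addr_ge0// -ler0c.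
exists s; split=> [l i j|i j].
  rewrite !ffunE /s !big_cons big_nil addr0 at1 mxE /=.
  have -> : (c + b / delta)%:C *: alpha (a l) n x0 i j + v (Some l, i, j) -
      ((b / delta)%:C * alpha (a l) n x0 i j + corner_eval (alpha (a l)) (at0 Y) i j) =
      err l i j.
    by rewrite /err /GRing.scale/= rmorphD; ring.
  apply: le_trans (errB _ _ _) _.
  rewrite /mass !big_cons big_nil addr0 at1 linearZ/= mxtrace1 mulrDr.
  apply: ler_wpDr.
    by rewrite mulr_ge0 ?corner_trace_ge0// ler0c ltW.
  rewrite mulrA -rmorphM mulrC [delta * _]mulrC divfK ?gt_eqF//= bE.
  by rewrite -[X in X <= _]mul1r ler_wpM2r// ler1n.
have YE : corner_eval (aff_unit M) (at0 Y) = c%:C%:M + H.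
  by rewrite HY /corner_eval mulmx1.
have t0 : 0 <= (c + b / delta)%:C :> C by rewrite ler0c addr_ge0// -ler0c.
rewrite !ffunE /s !big_cons big_nil addr0 at1 YE /= alpha_e !mxE /GRing.scale/=.
rewrite [(_ * _ + _)^*%R]rmorphD [X in _ + (X + _)]rmorphM /= (geC0_conj t0).
rewrite conjC_nat (eq_sym j i) rmorphD -[c%:C *+ _]mulr_natr /=.
have key (u w p q k : C) : (p + q) * k + u + ((p + q) * k + w) =
    2 * (q * k + (p * k + (u + w) / 2)) by field.
exact: key.
Qed.

(* Mixing in a little of [x0] turns the weak inequality [F w <= 0] produced by
   [cone_state] into a strict one. *)
Let datum_mix_in_tube (t : R) : 0 < t <= 1 ->
  tube ((1 - t)%:C *: datum psi + t%:C *: ev0).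
Proof.
move=> /andP[t0 t1]; apply: contrapT => ntube.
have [F [lF FD Fe]] := cone_state tube_cone tube_order_unit ntube.
rewrite (real_linearD lF) !(real_linearZ lF) Fe mulr1 leNgt => /negP; apply.
rewrite ltr_wpDl// mulr_ge0 ?subr_ge0//.
have [c cE] := real_linear_ffunE lF.
(* [b] encodes the coefficients of [F]: pairing it with a map [h] gives the complex functional whose
   real part is [F], at the datum of [h]. *)
pose b : 'M[J]_n.+1 := \matrix_(i, j) \sum_o c (o, i, j) *: aa o.
have bE (h : {linear J -> 'M[C]_n.+1}) :
    \sum_i \sum_j h (b i j) i j = \sum_i c i * datum h i.
  transitivity (\sum_o \sum_i \sum_j c (o, i, j) * datum h (o, i, j)); last first.
    under eq_bigr do rewrite pair_bigA /=.
    rewrite pair_bigA /= (reindex (fun k : I => (k.1.1, (k.1.2, k.2)))) /=.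
      by apply: eq_bigr => -[[k i] j] _.
    by exists (fun k => (k.1, k.2.1, k.2.2)) => [[[k i] j] _|[k [i j]] _].
  rewrite [RHS]exchange_big /=; apply: eq_bigr => i _; rewrite [RHS]exchange_big /=.
  apply: eq_bigr => j _; rewrite mxE linear_sum summxE; apply: eq_bigr => o _.
  by rewrite linearZ !mxE ffunE.
rewrite cE -bE; apply: psi_pos => m x z.
pose p : corner := Tagged (fun m => (M m * 'M[C]_(m.+1, n.+1))%type) (x, z).
pose h b := corner_eval (alpha b) p.
have lh : linear h.
  by move=> d u w; rewrite /h linearP corner_eval_linear.
pose hL : {linear J -> 'M[C]_n.+1} := HB.pack h (GRing.isLinear.Build C J _ _ h lh).
have -> : blockform (affmx_eval (map_mx alpha b) x) z z = \sum_i \sum_j hL (b i j) i j.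
  rewrite corner_eval_blockform; apply: eq_bigr => i _; apply: eq_bigr => j _.
  by rewrite [map_mx _ _ _ _]mxE.
rewrite (bE hL) -cE; apply: FD.
exists [:: p]; split=> [l i j|i j].
  rewrite ffunE /mass !big_seq1 subrr normr0.
  by rewrite mulr_ge0 ?corner_trace_ge0// ler0c ltW.
rewrite !ffunE !big_seq1 /= /h alpha_e /corner_eval mulmx1 mulr_natl mulr2n.
congr (_ + _); rewrite !mxE rmorph_sum; apply: eq_bigr => k _.
by rewrite !mxE rmorphM /= conjCK mulrC.
Qed.

(** The [None] block of the mixed datum is the identity, so the corners are normalized and combine
    to a point of [M n]. Their mass is then [n.+1], which is the factor in the error. *)
Lemma mixed_state_approx (t : R) : 0 < t <= 1 -> exists x : M n, forall l i j,
  `|(1 - t)%:C * psi (a l) i j + t%:C * alpha (a l) n x0 i j - alpha (a l) n x i j|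
    <= (delta *+ n.+1)%:C.
Proof.
move=> /datum_mix_in_tube[s [sa se]].
have s1 : \sum_(p <- s) corner_eval (aff_unit M) p = 1%:M.
  apply/matrixP => i j; apply: (@mulfI C 2); first by rewrite pnatr_eq0.
  rewrite summxE -se !ffunE /= psi_e alpha_e /GRing.scale/= !mxE (eq_sym j i).
  by rewrite -mulrDl -rmorphD subrK mul1r conjC_nat mulr_natl mulr2n.
have [x xE] := corner_combination s1; exists x => l i j.
have := sa l i j; rewrite /mass -linear_sum s1 /= mxtrace1 !ffunE /= -summxE -xE.
by rewrite mulr_natr rmorphMn.
Qed.

End FiniteFamily.

Lemma matrix_state_approx r (a : 'I_r -> J) (eps : R) : 0 < eps ->
  exists x : M n, forall l i j, `|psi (a l) i j - alpha (a l) n x i j| <= eps%:C.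
Proof.
move=> eps0.
pose S : C := \sum_l \sum_i \sum_j `|psi (a l) i j - alpha (a l) n x0 i j|.
have S0 : 0 <= S by do 3![apply: sumr_ge0 => ? _].
have leS l i j : `|psi (a l) i j - alpha (a l) n x0 i j| <= S.
  exact: (ler_sum3_term (h := fun l i j => `|psi (a l) i j - alpha (a l) n x0 i j|)).
pose s := complex.Re S; have sE : S = s%:C by rewrite RRe_real// ger0_real.
have s0 : 0 <= s by rewrite -ler0c -sE.
have se0 : 0 < s + eps by rewrite ltr_wpDl.
(* The tolerance is divided by [n.+1] to make the approximation error [eps / 2]; the weight [t] is
   at most [1] and makes the error from mixing in [x0] at most [eps / 2]. *)
have [||x xP] := @mixed_state_approx r a (eps / 2 / n.+1%:R) _ (eps / 2 / (s + eps)).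
- by rewrite !divr_gt0.
- rewrite !divr_gt0//= ler_pdivrMr// mul1r ler_pdivrMr// mulr_natr mulr2n; lra.
exists x => l i j; set t := eps / 2 / (s + eps) in xP.
have -> : psi (a l) i j - alpha (a l) n x i j =
    ((1 - t)%:C * psi (a l) i j + t%:C * alpha (a l) n x0 i j - alpha (a l) n x i j) +
    t%:C * (psi (a l) i j - alpha (a l) n x0 i j).
  by rewrite rmorphB; ring.
apply: le_trans (ler_normD _ _) _.
have -> : eps%:C = (eps / 2)%:C + (eps / 2)%:C :> C by rewrite -rmorphD -splitr.
apply: lerD.
  by apply: le_trans (xP l i j) _; rewrite -[_ *+ n.+1]mulr_natr divfK// pnatr_eq0.
have t0 : 0 <= t by rewrite !divr_ge0// ltW.
rewrite normrM ger0_norm ?ler0c//.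
apply: (@le_trans _ _ (t%:C * S)); first by rewrite ler_wpM2l// ler0c.
rewrite sE -rmorphM lecR /t mulrAC ler_pdivrMr// ler_pM2l ?divr_gt0//.
by rewrite lerDl ltW.
Qed.

(** The sets of approximating points, indexed by a finite list and a tolerance, generate a proper
    filter on the compact [M n]; continuity gives exact equality at a cluster point. *)
Lemma matrix_state_eval : exists x : M n, forall a, alpha a n x = psi a.
Proof.
pose good (se : seq J * R) := [set x : M n | forall a, a \in se.1 ->
  forall i j, `|psi a i j - alpha a n x i j| <= se.2%:C].
pose F := filter_from [set se : seq J * R | 0 < se.2] good.
have FF : ProperFilter F.
  apply: filter_from_proper.
    apply: filter_from_filter; first by exists ([::], 1) => /=.
    move=> [s d] [s' d'] /= d0 d0'; exists (s ++ s', Num.min d d').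
      by rewrite /= lt_min d0.
    move=> x /= gx; split=> b bs i j /=; apply: le_trans (gx b _ i j) _;
      by rewrite ?mem_cat ?bs ?orbT// lecR ge_min lexx ?orbT.
  move=> [s d] /= d0; have [x xP] := matrix_state_approx (tnth (in_tuple s)) d0.
  exists x => b /= /(nthP 0)[k ks <-] i j.
  by have := xP (Ordinal ks) i j; rewrite (tnth_nth 0).
have [x [_ clx]] := compact_subtypeT (@cmc_compact _ _ M n) FF filterT.
exists x => b; apply/matrixP => i j; apply/eqP; rewrite eq_sym -subr_eq0 -normr_le0.
apply/ler_addgt0Pr => d d0; rewrite add0r.
have d20 : 0 < d / 2 by rewrite divr_gt0.
have dE : d / 2 = (complex.Re (d / 2))%:C by rewrite RRe_real// gtr0_real.
have Fb : F (good ([:: b], complex.Re (d / 2))).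
  by exists ([:: b], complex.Re (d / 2)) => //=; rewrite -ltcR -dE.
have Nx := @cvgr_dist_le _ C^o _ _ _ _ _ (@aff_continuous_entry _ _ _ (alpha b) n i j x) _ d20.
have [y [/(_ b (mem_head _ _) i j) yb yx]] := clx _ _ Fb (Nx _).
have -> : psi b i j - alpha b n x i j = (psi b i j - alpha b n y i j) -
    (alpha b n x i j - alpha b n y i j) by ring.
apply: le_trans (ler_normB _ _) _; rewrite [d]splitr; apply: lerD => //.
by rewrite dE.
Qed.

End MatrixState.

(** * Positivity of real parts *)

Section RealPart.
Variables (R : realType) (V : tvsType R[i]) (K : cmcset V).
Local Notation C := R[i].

Lemma blockform_real_part k (b : 'M[affmap K]_k) n (x : K n) (z : 'M[C]_(n.+1, k)) :
  blockform (affmx_eval (b + map_mx (@aff_star R V K) b^T) x) z z =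
  2 * (complex.Re (blockform (affmx_eval b x) z z))%:C.
Proof.
by rewrite affmx_evalD affmx_eval_star blockformDm -conj_blockform addcJ.
Qed.

(** This translates the real-part condition required by [matrix_state_eval] into positivity in the
    operator system. *)
Lemma affpos_real_part k (b : 'M[affmap K]_k.+1) :
  affpos (b + map_mx (@aff_star R V K) b^T) <->
  forall n (x : K n) z, 0 <= complex.Re (blockform (affmx_eval b x) z z).
Proof.
split=> pb n x z.
  by have := pb n x z; rewrite blockform_real_part pmulr_rge0 ?ler0c.
by rewrite blockform_real_part mulr_ge0// ler0c.
Qed.

Lemma blockform_id n (b : 'M[affmap K]_n.+1) (x : K n) :
  blockform (affmx_eval b x) 1%:M 1%:M = \sum_i \sum_j b i j n x i j.
Proof.
rewrite corner_eval_blockform; apply: eq_bigr => i _; apply: eq_bigr => j _.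
by rewrite /corner_eval /= mulmx1 trmx1 map_mx1 mul1mx.
Qed.

End RealPart.

Lemma set_type_continuous (X Y : topologicalType) (A : set Y) (g : X -> A) :
  continuous (fun x => val (g x)) -> continuous g.
Proof.
move=> cg x U [_ [[W oW <-] /= Wx WU]].
have Wn := cg x W (open_nbhs_nbhs (conj oW Wx)).
by apply: (@filterS _ (nbhs x) _ _ _ _ Wn) => y Wy; exact: WU.
Qed.

Lemma nc_embedding_ext (R : realType) (G : groupType) (S T : ncsys R G)
    (phi psi : {linear S -> T}) :
  phi =1 psi -> nc_embedding phi -> nc_embedding psi.
Proof.
move=> E [[[u cp] eq] [inj coi]].
have mE k (a : 'M[S]_k.+1) : map_mx psi a = map_mx phi a.
  by apply: eq_map_mx => x; rewrite E.
split; split; [split| |move=> a b|move=> k a].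
- by rewrite -E.
- by move=> k a; rewrite mE; exact: cp.
- by move=> s x; rewrite -!E.
- by rewrite -!E; exact: inj.
- by rewrite mE; exact: coi.
Qed.

(** * Composition, inclusion and invariant subsystems *)

Section Composition.
Variables (R : realType) (U V W : tvsType R[i]).
Variables (P : cmcset U) (L : cmcset W) (K : cmcset V).

Program Definition cma_comp (f : cma_map L K) (g : cma_map P L) : cma_map P K :=
  @CMAMap R U V P K (fun n x => f n (g n x)) _ _.
Next Obligation.
move=> f g n x; apply: (@continuous_comp _ _ _ (g n) (f n)); exact: cma_continuous.
Qed.
Next Obligation.
move=> f g n k m mu c nu c1 nuE; apply: cma_affine => //.
exact: (@cma_affine _ _ _ _ _ g n k m mu c nu c1 nuE).
Qed.

End Composition.

Section Inclusion.
Variables (R : realType) (W : tvsType R[i]) (L' L : cmcset W).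
Hypothesis sub : forall n, L' n `<=` L n.

Definition incl_fun n (x : L' n) : L n :=
  exist _ (val x) (mem_set (@sub n _ (set_valP x))).

Program Definition cma_incl : cma_map L' L := @CMAMap R W W L' L incl_fun _ _.
Next Obligation.
by move=> n; apply: set_type_continuous; exact: (@initial_continuous (L' n) _ set_val).
Qed.
Next Obligation. by move=> n k m mu g nu g1. Qed.

End Inclusion.

Section Subsystem.
Variables (R : realType) (W : tvsType R[i]) (G : groupType) (L : mads W G).
Variables (L' : cmcset W) (sub : forall n, L' n `<=` L n).
Hypothesis inv : forall s n (x : L n), L' n (val x) -> L' n (val (mads_act L s n x)).

Definition sub_act_fun s n (x : L' n) : L' n :=
  exist _ (val (mads_act L s n (cma_incl sub n x)))
    (mem_set (@inv s n (cma_incl sub n x) (set_valP x))).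

Program Definition sub_act s : cma_map L' L' := @CMAMap R W W L' L' (sub_act_fun s) _ _.
Next Obligation.
move=> s n; apply: set_type_continuous => x.
apply: (@continuous_comp _ _ _ (fun x => mads_act L s n (cma_incl sub n x)) set_val).
  apply: (@continuous_comp _ _ _ (cma_incl sub n) (mads_act L s n)); exact: cma_continuous.
exact: (@initial_continuous (L n) _ set_val).
Qed.
Next Obligation.
move=> s n k m mu g nu g1 nuE.
exact: (@cma_affine _ _ _ _ _ (mads_act L s) n k m
  (fun i => cma_incl sub (m i) (mu i)) g (cma_incl sub n nu) g1 nuE).
Qed.

Lemma sub_actM s t n x : sub_act (s * t)%g n x = sub_act s n (sub_act t n x).
Proof.
apply: val_inj; rewrite /= mads_actM; congr (val (mads_act L s n _)).
exact: val_inj.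
Qed.

Lemma sub_act1 n x : sub_act 1%g n x = x.
Proof. by apply: val_inj; rewrite /= mads_act1. Qed.

Lemma sub_act_homeo s n : homeomorphic_map (sub_act s n).
Proof.
split; first exact: cma_continuous.
exists (sub_act s^-1%g n); split; first exact: cma_continuous.
  by move=> x; rewrite -sub_actM mulVg sub_act1.
by move=> x; rewrite -sub_actM mulgV sub_act1.
Qed.

Definition sub_mads : mads W G := MADS sub_act_homeo sub_actM.

Lemma cma_incl_equivariant : @cma_equivariant _ _ _ _ sub_mads L (cma_incl sub).
Proof. by move=> s n x; exact: val_inj. Qed.

End Subsystem.

(** * From essential extensions to boundaries *)

Lemma essential_boundary (R : realType) (V W : tvsType R[i]) (hW : hausdorff_space W)
    (G : groupType) (K : mads V G) (L : mads W G) (f : cma_map L K)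
    (feq : cma_equivariant f) (fsurj : cma_surjective f) :
  is_essential (aff_extension feq fsurj) -> is_boundary f.
Proof.
move=> ess L' sub inv surj n.
pose P := sub_mads sub inv; pose j : cma_map P L := cma_incl sub.
pose phi : {linear aff_ncsys L -> aff_ncsys P} := aff_precomp j.
have jeq : cma_equivariant j by exact: cma_incl_equivariant.
have phim : nc_morphism phi.
  split; first exact: aff_precomp_ucp.
  by move=> s a; apply: affmapP => m x; congr (a m _); rewrite jeq.
pose g : cma_map P K := cma_comp f j.
have geq : cma_equivariant g by move=> s m x; rewrite -[RHS]feq -jeq.
have gsurj : cma_surjective g.
  move=> m y; have : (f m @` [set x : L m | L' m (val x)]) y by rewrite surj.
  move=> [x /= L'x <-]; pose x' : P m := exist _ (val x) (mem_set L'x).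
  by exists x'; rewrite /=; congr (f m _); exact: val_inj.
have [_ [_ coi]] : nc_embedding phi.
  apply: (ess (aff_ncsys P) phi phim).
  apply: nc_embedding_ext (aff_precomp_embedding geq gsurj) => a.
  exact: affmapP.
apply/seteqP; split; first exact: sub.
move=> v Lv; pose x : L n := exist _ v (mem_set Lv).
(* Applying [matrix_state_eval] requires some point of [L'] at level [n]; surjectivity onto [K]
   provides it. *)
have [x0 _] := gsurj n (f n x).
have lev : linear (fun a : affmap L => a n x : 'M[R[i]]_n.+1) by [].
pose ev : {linear affmap L -> 'M[R[i]]_n.+1} :=
  HB.pack (fun a : affmap L => a n x : 'M[R[i]]_n.+1)
    (GRing.isLinear.Build R[i] (affmap L) _ _ _ lev).
have [||b bP|y yP] := @matrix_state_eval R W P _ (phi : {linear affmap L -> affmap P})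
    n ev (aff_unit L) x0.
- exact: affmapP.
- by [].
(* If the real part of [b] is nonnegative over [L'], then [phi] sends [b + b^*] to a positive
   element; since [phi] reflects positivity, [b + b^*] is positive over [L], in particular at
   [x]. *)
- rewrite -blockform_id; suff : affpos (b + map_mx (@aff_star R W L) b^T).
    by move=> /affpos_real_part; apply.
  apply/(coi _ (b + _)).
  have -> : map_mx phi (b + map_mx (@aff_star R W L) b^T) =
      map_mx phi b + map_mx (@aff_star R W P) (map_mx phi b)^T.
    apply/matrixP => k l; rewrite !mxE raddfD; congr (_ + _).
    exact: affmapP.
  exact/affpos_real_part.
have xy : x = j n y by apply: (aff_separates hW) => a; rewrite -[LHS]/(ev a) -yP.
by rewrite -[v]/(val x) xy; exact: (set_valP y).
Qed.

(** * Abstract operator systems *)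

Section OperatorSystemTheory.
Variable R : realType.
Local Notation C := R[i].

(** The order unit axiom supplies a positive element, and scaling it by [0] keeps it positive. *)
Lemma os_pos0 (S : opsys R) k : os_pos (0 : 'M[S]_k.+1).
Proof.
have h0 : map_mx (@os_star R S) (0 : 'M[S]_k.+1)^T = 0.
  apply/matrixP => i j; rewrite !mxE -(scale0r (0 : S)) os_starZ conjC0.
  by rewrite !scale0r.
have [r r0 pr] := os_order_unit h0.
have -> : 0 = map_mx ( *:%R 0) ((\matrix_(i, j) if i == j then r *: os_unit S else 0) +
    (0 : 'M[S]_k.+1)).
  by apply/matrixP => i j; rewrite !mxE scale0r.
exact: os_posZ.
Qed.

Lemma map_mxscale (S T : lmodType C) (phi : {linear S -> T}) m n c (a : 'M[S]_(m, n)) :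
  map_mx phi (map_mx ( *:%R c) a) = map_mx ( *:%R c) (map_mx phi a).
Proof. by apply/matrixP => i j; rewrite !mxE linearZ. Qed.

Lemma ucp_star (S T : opsys R) (phi : {linear S -> T}) x :
  unital_cp phi -> phi (os_star x) = os_star (phi x).
Proof.
move=> [phi1 cp].
have herm u : os_star u = u -> os_star (phi u) = phi u.
  move=> hu; pose a : 'M[S]_1 := const_mx u.
  have ha : map_mx (@os_star R S) a^T = a.
    by apply/matrixP => i j; rewrite !mxE hu.
  have [r r0 /cp/os_pos_herm/matrixP/(_ 0 0)] := os_order_unit ha.
  rewrite !mxE eqxx raddfD /= linearZ phi1 os_starD os_starZ os_star_unit.
  by rewrite geC0_conj ?ltW// => /addrI.
pose u := x + os_star x; pose v := 'i%R *: (x - os_star x).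
have starN (P : opsys R) (w : P) : os_star (- w) = - os_star w.
  by rewrite -[in LHS]scaleN1r os_starZ rmorphN1 scaleN1r.
have hu : os_star u = u by rewrite /u os_starD os_starK addrC.
have hv : os_star v = v.
  by rewrite /v os_starZ os_starD starN os_starK conjCi scaleNr -scalerN opprB.
have iv : 'i%R *: v = os_star x - x.
  by rewrite scalerA -expr2 sqrCi scaleN1r opprB.
have x2 : (2 : C) *: x = u - 'i%R *: v.
  by rewrite iv /u opprB addrACA subrr addr0 scaler_nat mulr2n.
have s2 : (2 : C) *: os_star x = u + 'i%R *: v.
  by rewrite iv /u [os_star x - x]addrC addrACA subrr add0r scaler_nat mulr2n.
apply: (@scalerI _ _ (2 : C)); first by rewrite pnatr_eq0.
rewrite -linearZ s2 [phi (u + _)]linearD /= [phi ('i%R *: v)]linearZ /=.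
have <- : os_star ((2 : C) *: phi x) = 2 *: os_star (phi x).
  by rewrite os_starZ conjC_nat.
rewrite -[_ *: phi x]linearZ x2 [phi (u - _)]linearB /=.
rewrite [phi ('i%R *: v)]linearZ /= os_starD starN os_starZ conjCi.
by rewrite scaleNr opprK (herm _ hu) (herm _ hv).
Qed.

End OperatorSystemTheory.

(** * Matrix convex combinations and block forms *)

Section MatrixConvexTheory.
Variables (R : realType) (W : tvsType R[i]).
Local Notation C := R[i].

Lemma mxcomp_scalar n (s : C) (a : 'M[W]_n) :
  mxcomp s%:M a = map_mx ( *:%R (s^*%R * s)) a.
Proof.
rewrite -scalemx1; apply/matrixP => i j; rewrite -[in RHS](mxcomp_id a) !mxE.
rewrite scaler_sumr; apply: eq_bigr => k _; rewrite scaler_sumr.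
by apply: eq_bigr => l _; rewrite !mxE rmorphM /= scalerA mulrACA.
Qed.

(** An ordinary convex combination is the matrix convex combination with scalar coefficients the
    square roots of [t] and [1 - t]. *)
Lemma matrix_convex_combinations (L : forall n, set 'M[W]_n.+1) :
  (forall n k (m : 'I_k -> nat) (mu : forall i, 'M[W]_((m i).+1))
     (g : forall i, 'M[C]_((m i).+1, n.+1)),
     (forall i, L (m i) (mu i)) ->
     \sum_i (g i)^t* *m g i = 1%:M ->
     L n (\sum_i mxcomp (g i) (mu i))) ->
  matrix_convex L.
Proof.
move=> cL; split=> // n t mu nu t0 t1 Lmu Lnu.
have t1' : 0 <= 1 - t by rewrite subr_ge0.
pose g (i : 'I_2) : 'M[C]_n.+1 := (sqrtC (if i == 0 then t else 1 - t))%:M.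
have sq (c : C) : 0 <= c -> (sqrtC c)^*%R * sqrtC c = c.
  by move=> c0; rewrite geC0_conj ?sqrtC_ge0// -expr2 sqrtCK.
have := cL n 2 (fun=> n) (fun i => if i == 0 then mu else nu) g.
rewrite !big_ord_recl !big_ord0 !addr0 /= !mxcomp_scalar !sq//; apply.
  by move=> i; case: ifP.
rewrite !tr_scalar_mx !map_scalar_mx -!scalar_mxM !sq//.
by rewrite -raddfD /= addrC subrK.
Qed.

Lemma blockform_combination (L : cmcset W) k (a : 'M[affmap L]_k) n l
    (m : 'I_l -> nat) (mu : forall i, L (m i)) (g : forall i, 'M[C]_((m i).+1, n.+1))
    (nu : L n) (z : 'M[C]_(n.+1, k)) :
  \sum_i (g i)^t* *m g i = 1%:M ->
  val nu = \sum_i mxcomp (g i) (val (mu i)) ->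
  blockform (affmx_eval a nu) z z =
  \sum_i blockform (affmx_eval a (mu i)) (g i *m z) (g i *m z).
Proof.
move=> g1 nuE; pose c i p q := cform (a p q (m i) (mu i))
  (col p (g i *m z)) (col q (g i *m z)).
transitivity (\sum_p \sum_q \sum_i c i p q); last first.
  rewrite exchange_big /=; under eq_bigr do rewrite exchange_big /=.
  rewrite exchange_big /=; apply: eq_bigr => i _; rewrite blockformE exchange_big /=.
  by apply: eq_bigr => p _; apply: eq_bigr => q _; rewrite mxE.
rewrite blockformE; apply: eq_bigr => p _; apply: eq_bigr => q _.
rewrite mxE (aff_affine (a p q) g1 nuE) cform_summ; apply: eq_bigr => i _.
by rewrite /c mxcompE /cform !colE !adjmxM !mulmxA.
Qed.

(** The vector [z] is absorbed into the matrix of functions, so positivity at a point of level [n],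
    for every [k], reduces to matrices of size [n.+1] and the pairing of [blockform_id]. *)
Lemma blockform_mxcomp (L : cmcset W) k (a : 'M[affmap L]_k) n (x : L n)
    (z : 'M[C]_(n.+1, k)) :
  blockform (affmx_eval a x) z z =
  blockform (affmx_eval (mxcomp z^T a) x) 1%:M 1%:M.
Proof.
rewrite blockform_id blockformE.
pose c i j p q := (z p i)^*%R * z q j * a i j n x p q.
transitivity (\sum_i \sum_j \sum_p \sum_q c i j p q).
  apply: eq_bigr => i _; apply: eq_bigr => j _.
  rewrite mxE /cform !mxE exchange_big /=; apply: eq_bigr => q _.
  rewrite !mxE mulr_suml; apply: eq_bigr => p _.
  by rewrite !mxE /c mulrAC.
transitivity (\sum_p \sum_q \sum_i \sum_j c i j p q).
  under eq_bigr do rewrite exchange_big.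
  rewrite exchange_big; apply: eq_bigr => p _ /=.
  under eq_bigr do rewrite exchange_big.
  by rewrite exchange_big.
apply: eq_bigr => p _; apply: eq_bigr => q _.
rewrite mxE aff_sumE summxE; apply: eq_bigr => i _.
by rewrite aff_sumE summxE; apply: eq_bigr => j _; rewrite affZE !mxE.
Qed.

End MatrixConvexTheory.

(** * Closedness of positivity conditions *)

Section NonnegClosed.
Variables (R : realType) (X : topologicalType).
Local Notation C := R[i].

(** Nonnegativity of a complex number is the equation of the number with its modulus, which passes
    to limits. *)
Lemma closed_complex_ge0 (h : X -> C^o) : continuous h -> closed [set x | 0 <= (h x : C)].
Proof.
move=> ch x clx; suff : `|(h x : C)| - h x = 0.
  by move=> /eqP; rewrite subr_eq0 => /eqP hx; rewrite /= -hx.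
apply/eqP; rewrite -normr_le0; apply/ler_addgt0Pr => d d0; rewrite add0r.
have d20 : 0 < d / 2 by rewrite divr_gt0.
have Nx := @cvgr_dist_le _ C^o _ _ _ _ _ (ch x) _ d20.
have [y [/= y0 yx]] := clx _ (Nx _).
have -> : `|(h x : C)| - h x = (`|(h x : C)| - `|(h y : C)|) + (h y - h x).
  by rewrite (ger0_norm y0) addrA subrK.
apply: le_trans (ler_normD _ _) _; rewrite [d]splitr; apply: lerD.
  by apply: le_trans (ler_dist_dist _ _) _.
by rewrite distrC.
Qed.

Lemma continuous_sum (I : Type) (r : seq I) (h : I -> X -> C^o) :
  (forall i, continuous (h i)) -> continuous (fun x => \sum_(i <- r) h i x : C^o).
Proof.
move=> ch; elim: r => [|i r IH].
  rewrite (_ : (fun _ => _) = fun=> 0); first exact: cst_continuous.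
  by apply/funext => x; rewrite big_nil.
rewrite (_ : (fun _ => _) = fun x => h i x + \sum_(j <- r) h j x); first exact: contD.
by apply/funext => x; rewrite big_cons.
Qed.

End NonnegClosed.

Lemma blockform_continuous (R : realType) (W : tvsType R[i]) (L : cmcset W) k
    (a : 'M[affmap L]_k) n (z : 'M[R[i]]_(n.+1, k)) :
  continuous (fun x : L n => blockform (affmx_eval a x) z z : R[i]^o).
Proof.
under eq_fun do rewrite blockform_mxcomp blockform_id.
by apply: continuous_sum => i; apply: continuous_sum => j; exact: aff_continuous_entry.
Qed.

(** * The invariant compact matrix convex set where [phi]-positive elements are positive *)

Section PositivityLocus.
Variables (R : realType) (W : tvsType R[i]) (G : groupType) (L : mads W G).
Variables (Q : ncsys R G) (phi : {linear aff_ncsys L -> Q}).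
Hypothesis phim : nc_morphism phi.
Local Notation C := R[i].

Definition positive_at n (x : L n) :=
  forall k (a : 'M[affmap L]_k.+1), os_pos (map_mx phi a) -> blockpos (affmx_eval a x).

Definition positivity_locus n : set 'M[W]_n.+1 :=
  [set val x | x in [set x : L n | positive_at x]].

Lemma positivity_locus_sub n : @positivity_locus n `<=` L n.
Proof. by move=> _ [x _ <-]; exact: set_valP. Qed.

Lemma positivity_locusP n (x : L n) : @positivity_locus n (val x) <-> positive_at x.
Proof. by split=> [[y py /val_inj <-]|px]; last exists x. Qed.

Lemma positivity_locus_convex : matrix_convex (@positivity_locus).
Proof.
apply: matrix_convex_combinations => n k m mu g Lmu g1.
have sel i : {x : L (m i) | positive_at x /\ val x = mu i}.
  by apply: cid; have [x px xE] := Lmu i; exists x.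
pose nu i := sval (sel i).
have nuE i : val (nu i) = mu i by have [] := svalP (sel i).
have pnu i : positive_at (nu i) by have [] := svalP (sel i).
have Lx : L n (\sum_i mxcomp (g i) (mu i)).
  by apply: (@cmc_convex _ _ L).2 => // i; rewrite -nuE; exact: set_valP.
pose x : L n := exist _ (\sum_i mxcomp (g i) (mu i)) (mem_set Lx).
exists x => // l a pa z.
rewrite (@blockform_combination _ _ _ _ a _ _ _ nu g x z g1).
  by apply: sumr_ge0 => i _; exact: pnu.
by apply: eq_bigr => i _; rewrite nuE.
Qed.

(** The positive points are cut out of the compact [L n] by closed conditions, one for each [a] and
    [z]. *)
Lemma positivity_locus_compact n : compact (@positivity_locus n).
Proof.
apply: continuous_compact.
  by apply: continuous_subspaceT; exact: (@initial_continuous (L n) _ set_val).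
apply: subclosed_compact (compact_subtypeT (@cmc_compact _ _ L n)) _ => //.
move=> x clx k a pa z.
apply: (closed_complex_ge0 (@blockform_continuous _ _ _ _ a n z)).
by apply: closureS clx => y py; exact: py.
Qed.

Definition positivity_cmcset : cmcset W :=
  CMCSet positivity_locus_convex positivity_locus_compact.

(** The value of [a] at [s x] is the value at [x] of [a] translated by [s^-1], and equivariance
    keeps the image of the translate positive. *)
Lemma positivity_locus_invariant s n (x : L n) :
  @positivity_locus n (val x) -> @positivity_locus n (val (mads_act L s n x)).
Proof.
move=> /positivity_locusP px; apply/positivity_locusP => k a pa.
have E : affmx_eval (map_mx (aff_act L s^-1%g) a) x = affmx_eval a (mads_act L s n x).
  by rewrite affmx_eval_pull invgK.
rewrite -E; apply: px.
have -> : map_mx phi (map_mx (aff_act L s^-1%g) a) =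
    map_mx (nc_act Q s^-1%g) (map_mx phi a).
  by apply/matrixP => i j; rewrite !mxE; exact: phim.2.
exact/(nc_act_coi Q s^-1%g).2.
Qed.

(** At full locus [phi] reflects positivity. An element of its kernel and the opposite element both
    have positive image [0], so both are positive and the element is zero. *)
Lemma positivity_locus_full : (forall n, @positivity_locus n = L n) -> nc_embedding phi.
Proof.
move=> LE; have pall n (x : L n) : positive_at x.
  by apply/positivity_locusP; rewrite LE; exact: set_valP.
have coi k (a : 'M[affmap L]_k.+1) : os_pos (map_mx phi a) <-> affpos a.
  split=> [pa n x|]; first exact: pall.
  exact: phim.1.2.
split=> //; split=> // a b ab.
have kerP (c : affmap L) : phi c = 0 -> affpos (const_mx c : 'M[affmap L]_1).
  move=> c0; apply/coi; have -> : map_mx phi (const_mx c : 'M[affmap L]_1) = 0.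
    by apply/matrixP => i j; rewrite !mxE.
  exact: os_pos0.
have phiB (c d : affmap L) : phi c = phi d -> phi (c - d) = 0.
  by move=> cd; rewrite (raddfB phi c d); apply/eqP; rewrite subr_eq0; apply/eqP.
have pab : affpos (const_mx (a - b) : 'M[affmap L]_1) by apply: kerP; exact: phiB.
have pba : affpos (- (const_mx (a - b) : 'M[affmap L]_1)).
  have -> : - (const_mx (a - b) : 'M[affmap L]_1) = const_mx (b - a).
    by apply/matrixP => i j; rewrite !mxE opprB.
  by apply: kerP; exact: phiB.
by have /matrixP/(_ 0 0) := affpos_proper pab pba; rewrite !mxE => /subr0_eq.
Qed.

End PositivityLocus.

(** * Extending a point evaluation on A(K) to a matrix state of A(L) compatible with [phi] *)

Section StateExtension.
Variables (R : realType) (V W : tvsType R[i]) (hV : hausdorff_space V).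
Variables (G : groupType) (K : mads V G) (L : mads W G) (f : cma_map L K).
Hypothesis fsurj : cma_surjective f.
Variables (Q : ncsys R G) (phi : {linear aff_ncsys L -> Q}).
Hypothesis phi_ucp : unital_cp phi.
Hypothesis phi_coi : forall k (c : 'M[affmap K]_k.+1),
  os_pos (map_mx phi (map_mx (aff_pull f) c)) -> affpos c.
Local Notation C := R[i].
Variables (n : nat) (y : K n).
Local Notation E := {ffun 'I_n.+1 * 'I_n.+1 -> affmap L}.

(** Twice the real part. Through it, [T] expresses positivity of the real part of [phi d] for
    arbitrary [d], which suits the real functionals of [cone_state]. *)
Let rp (U : tvsType C) (M : cmcset U) (b : 'M[affmap M]_n.+1) :=
  b + map_mx (@aff_star R U M) b^T.

Let T (d : 'M[affmap L]_n.+1) : 'M[Q]_n.+1 := map_mx phi (rp d).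

Let phiD (a b : affmap L) : phi (a + b) = phi a + phi b.
Proof. exact: (raddfD phi). Qed.

Let phiZ c (a : affmap L) : phi (c *: a) = c *: phi a.
Proof. exact: (linearZZ phi). Qed.

Let TD a b : T (a + b) = T a + T b.
Proof.
apply/matrixP => i j; rewrite !mxE -phiD; congr (phi _).
by rewrite aff_starD addrACA.
Qed.

Let TZ (t : R) a : T (map_mx ( *:%R t%:C) a) = map_mx ( *:%R t%:C) (T a).
Proof.
apply/matrixP => i j; rewrite !mxE -phiZ; congr (phi _).
by rewrite aff_starZ scalerDr [_^*%R](conjc_real t).
Qed.

Let T0 : T 0 = 0.
Proof. by apply: (addrI (T 0)); rewrite -TD !addr0. Qed.

Let TE d : T d = map_mx phi d + map_mx (@os_star R Q) (map_mx phi d)^T.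
Proof.
apply/matrixP => i j; rewrite !mxE phiD; congr (_ + _).
exact: (ucp_star (S := affsys L) _ phi_ucp).
Qed.

Let T_affpos d : affpos (rp d) -> os_pos (T d).
Proof. exact: phi_ucp.2. Qed.

Let ev (b : 'M[affmap K]_n.+1) : C := \sum_i \sum_j b i j n y i j.

Let evD a b : ev (a + b) = ev a + ev b.
Proof.
rewrite /ev -big_split; apply: eq_bigr => i _; rewrite -big_split.
by apply: eq_bigr => j _; rewrite !mxE.
Qed.

Let evZ c a : ev (map_mx ( *:%R c) a) = c * ev a.
Proof.
rewrite /ev mulr_sumr; apply: eq_bigr => i _; rewrite mulr_sumr.
by apply: eq_bigr => j _; rewrite !mxE.
Qed.

Let one (U : tvsType C) (M : cmcset U) : 'M[affmap M]_n.+1 := aff_order_unit M n.+1 1.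

Let ev1 : ev (one K) = n.+1%:R.
Proof.
transitivity (\sum_(i < n.+1) (1 : C)); last by rewrite sumr_const card_ord.
apply: eq_bigr => i _.
rewrite (bigD1 i)//= big1 ?addr0 => [|j ji]; first by rewrite !mxE eqxx scale1r mxE eqxx.
by rewrite !mxE eq_sym (negbTE ji) mxE.
Qed.

Let iota := map_mx (aff_pull f) : 'M[affmap K]_n.+1 -> 'M[affmap L]_n.+1.

Let iota1 : iota (one K) = one L.
Proof.
apply/matrixP => i j; rewrite !mxE; case: eqP => _; last by rewrite raddf0.
by rewrite linearZ; congr (_ *: _); exact: affmapP.
Qed.

Let iotaD a b : iota (a + b) = iota a + iota b.
Proof. by apply/matrixP => i j; rewrite !mxE raddfD. Qed.

Let iotaZ c a : iota (map_mx ( *:%R c) a) = map_mx ( *:%R c) (iota a).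
Proof. exact: map_mxscale. Qed.

Let T_iota b : os_pos (T (iota b)) -> 0 <= complex.Re (ev b).
Proof.
have -> : T (iota b) = map_mx phi (map_mx (aff_pull f) (rp b)).
  apply/matrixP => i j; rewrite !mxE; congr (phi _); rewrite raddfD /=.
  by congr (_ + _); exact: affmapP.
by move=> /phi_coi/affpos_real_part/(_ n y 1%:M); rewrite blockform_id.
Qed.

(** Finite functions carry the scalar structure required by [cone_state]; [mx] and [un] pass between
    them and matrices. *)
Let mx (d : E) : 'M[affmap L]_n.+1 := \matrix_(i, j) d (i, j).
Let un (b : 'M[affmap L]_n.+1) : E := [ffun k => b k.1 k.2].

Let unK b : mx (un b) = b.
Proof. by apply/matrixP => i j; rewrite mxE ffunE. Qed.

Let mxD c d : mx (c + d) = mx c + mx d.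
Proof. by apply/matrixP => i j; rewrite !mxE ffunE. Qed.

Let mxZ t d : mx (t *: d) = map_mx ( *:%R t) (mx d).
Proof. by apply/matrixP => i j; rewrite !mxE ffunE. Qed.

Let unD a b : un (a + b) = un a + un b.
Proof. by apply/ffunP => k; rewrite !ffunE mxE. Qed.

Let unZ c a : un (map_mx ( *:%R c) a) = c *: un a.
Proof. by apply/ffunP => k; rewrite !ffunE mxE. Qed.

(* The cone generated by the elements that [phi] makes positive and by the
   elements of [A(K)] whose value at [y] is positive: a state of it extends
   the evaluation at [y] and is positive for [phi]. *)
Let D : set E := [set d | exists2 b, 0 <= complex.Re (ev b) & os_pos (T (mx d - iota b))].

Let D_cone : convex_cone D.
Proof.
have mx0 : mx 0 = 0 by apply/matrixP => i j; rewrite !mxE ffunE.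
have iota0 : iota 0 = 0 by apply/matrixP => i j; rewrite !mxE raddf0.
have ev0 : ev 0 = 0 by apply: (addrI (ev 0)); rewrite -evD !addr0.
split=> [|c d [a a0 pa] [b b0 pb]|t d t0 [b b0 pb]].
- by exists 0; rewrite ?ev0// mx0 iota0 subr0 T0; exact: os_pos0.
- exists (a + b); first by rewrite evD raddfD addr_ge0.
  by rewrite mxD iotaD opprD addrACA TD; exact: os_posD.
- have tE (z : C) : complex.Re (t%:C * z) = t * complex.Re z.
    by case: z => u v /=; rewrite mul0r subr0.
  exists (map_mx ( *:%R t%:C) b); first by rewrite evZ tE mulr_ge0.
  have -> : mx (t%:C *: d) - iota (map_mx ( *:%R t%:C) b) =
      map_mx ( *:%R t%:C) (mx d - iota b).
    by rewrite mxZ iotaZ; apply/matrixP => i j; rewrite !mxE scalerBr.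
  by rewrite TZ; apply: os_posZ => //; rewrite ler0c.
Qed.

Let T1_pos d : exists2 t : R, 0 <= t & os_pos (T (map_mx ( *:%R t%:C) (one L) + d)).
Proof.
have hd : map_mx (@aff_star R W L) (rp d)^T = rp d.
  by apply/matrixP => i j; rewrite !mxE aff_starD aff_starK addrC.
have [r r0 pr] := aff_unitP hd; have rE : r = (complex.Re r)%:C.
  by rewrite RRe_real// gtr0_real.
(* Half of [r] is enough because [rp] doubles the unit. *)
exists (complex.Re r / 2); first by rewrite divr_ge0// -ler0c -rE ltW.
apply: T_affpos; congr (affpos _): pr; apply/matrixP => i j; rewrite !mxE.
rewrite (eq_sym j i); case: (i == j); last by rewrite !(scaler0, add0r).
rewrite scale1r aff_starD aff_starZ aff_star_unit [_^*%R]conjc_real addrACA.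
by rewrite -scalerDl -rmorphD -splitr /= -rE.
Qed.

Let ext_state : exists F : E -> R, [/\ real_linear F,
  forall d, os_pos (T d) -> 0 <= F (un d) &
  forall b, F (un (iota b)) = complex.Re (ev b)].
Proof.
have iota0 : iota 0 = 0 by apply/matrixP => i j; rewrite !mxE raddf0.
have ev0 : ev 0 = 0 by apply: (addrI (ev 0)); rewrite -evD !addr0.
have [x|[b b0 pb]|F [lF FD F1 _]] := @cone_state R E D (un (one L)) (- un (one L)) D_cone.
- have [t t0 pt] := T1_pos (mx x); exists t => //; exists 0; first by rewrite ev0.
  by rewrite iota0 subr0 mxD mxZ unK.
(* The negative of the unit is outside [D]: otherwise [T] would be positive at [iota] of
   [- (1 + b)], whose pairing at [y] has real part at most [- n.+1]. *)
- suff : 0 <= complex.Re (ev (map_mx ( *:%R (-1)) (one K + b))).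
    rewrite evZ evD ev1 mulN1r raddfN raddfD /= oppr_ge0 leNgt => /negP; apply.
    rewrite ltr_wpDr//; have -> : n.+1%:R = (n.+1%:R)%:C :> C by rewrite rmorph_nat.
    by rewrite ltr0n.
  apply: T_iota; congr (os_pos (T _)): pb.
  rewrite iotaZ iotaD iota1; apply/matrixP => i j.
  by rewrite !mxE !ffunE mxE scaleN1r opprD.
have Fpos d : os_pos (T d) -> 0 <= F (un d).
  by move=> pd; apply: FD; exists 0; rewrite ?ev0// iota0 subr0 unK.
have Fiota b : 0 <= complex.Re (ev b) -> 0 <= F (un (iota b)).
  by move=> b0; apply: FD; exists b; rewrite // unK subrr T0; exact: os_pos0.
have N0 : (n.+1%:R : R) != 0 by rewrite pnatr_eq0.
(* [F] is [1] at the unit matrix while [ev] is [n.+1] there. *)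
exists (fun d => n.+1%:R * F d); split.
- by move=> t c d; rewrite lF mulrDr mulrCA.
- by move=> d pd; rewrite mulr_ge0// Fpos.
(* Subtracting a multiple of the unit makes the real part of [ev] zero; then [iota b0] and its
   opposite both lie in [D], which forces [F] to vanish there. *)
move=> b; pose r := complex.Re (ev b) / n.+1%:R.
pose b0 := b + map_mx ( *:%R (- r)%:C) (one K).
have Rev : complex.Re (ev b0) = 0.
  rewrite /b0 evD evZ ev1 raddfD /=.
  have -> : n.+1%:R = (n.+1%:R)%:C :> C by rewrite rmorph_nat.
  by rewrite -rmorphM /= mulNr divfK// subrr.
have : F (un (iota b0)) = 0.
  apply/eqP; rewrite eq_le Fiota ?Rev// andbT -oppr_ge0 -(real_linearN lF).
  have -> : - un (iota b0) = un (iota (map_mx ( *:%R (-1)) b0)).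
    by rewrite iotaZ unZ scaleN1r.
  by apply: Fiota; rewrite evZ mulN1r raddfN /= Rev oppr0.
rewrite /b0 iotaD iotaZ iota1 unD unZ (real_linearD lF) (real_linearZ lF) F1 mulr1.
by move=> /subr0_eq ->; rewrite mulrC divfK.
Qed.

Lemma positive_preimage : exists x : L n, positive_at phi x /\ f n x = y.
Proof.
have [F [lF Fpos Fiota]] := ext_state.
have [Phi PhiE] := real_linear_complexify lF.
have Phi_iota b : Phi (un (iota b)) = ev b.
  rewrite PhiE Fiota -unZ -iotaZ Fiota evZ mulrC ReiNIm opprK.
  by case: (ev b).
(* Evaluating [Phi] on matrices with one nonzero entry recovers the matrix-valued map [psi] that
   corresponds to [Phi]. *)
pose ent i j (a : affmap L) : E := [ffun k => if k == (i, j) then a else 0].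
have entL i j : linear (ent i j).
  move=> c a b; apply/ffunP => k; rewrite !ffunE; case: eqP => // _.
  by rewrite scaler0 addr0.
pose psi0 a : 'M[C]_n.+1 := \matrix_(i, j) Phi (ent i j a).
have psiL : linear psi0.
  by move=> c a b; apply/matrixP => i j; rewrite !mxE entL linearP.
pose psi : {linear affmap L -> 'M[C]_n.+1} :=
  HB.pack psi0 (GRing.isLinear.Build C (affmap L) _ _ psi0 psiL).
have psi_iota c : psi (aff_pull f c) = c n y.
  apply/matrixP => i j; rewrite mxE.
  pose b : 'M[affmap K]_n.+1 := \matrix_(k, l) if (k, l) == (i, j) then c else 0.
  have -> : ent i j (aff_pull f c) = un (iota b).
    by apply/ffunP => -[k l]; rewrite !ffunE !mxE /=; case: eqP => //; rewrite raddf0.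
  rewrite Phi_iota /ev (bigD1 i)//= (bigD1 j)//= mxE eqxx.
  rewrite big1 => [|l lj]; last by rewrite mxE xpair_eqE (negbTE lj) andbF mxE.
  rewrite big1 ?addr0// => k ki; rewrite big1// => l _.
  by rewrite mxE xpair_eqE (negbTE ki) mxE.
have psi_un (b : 'M[affmap L]_n.+1) : \sum_i \sum_j psi (b i j) i j = Phi (un b).
  have -> : un b = \sum_i \sum_j ent i j (b i j).
    apply/ffunP => -[k l]; rewrite sum_ffunE (bigD1 k)//= sum_ffunE (bigD1 l)//=.
    rewrite !ffunE eqxx big1 => [|j jl]; last first.
      by rewrite ffunE xpair_eqE eq_sym (negbTE jl) andbF.
    rewrite big1 ?addr0// => i ik; rewrite sum_ffunE big1// => j _.
    by rewrite ffunE xpair_eqE eq_sym (negbTE ik).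
  rewrite linear_sum; apply: eq_bigr => i _; rewrite linear_sum.
  by apply: eq_bigr => j _; rewrite mxE.
have [x0 _] := fsurj y.
have [|||x xP] := @matrix_state_eval R W L _ idfun n psi (aff_unit L) x0.
- by [].
- by rewrite -[1%:M]/(aff_unit K n y) -psi_iota; congr (psi _); exact: affmapP.
- move=> b pb; rewrite psi_un PhiE /=; apply/Fpos/T_affpos/affpos_real_part => m x z.
  by have := pb m x z; rewrite map_mx_id.
exists x; split; last first.
  by apply: (aff_separates hV) => c; rewrite -psi_iota -xP.
move=> k a pa z; rewrite blockform_mxcomp blockform_id.
set d := mxcomp z^T a.
have -> : \sum_i \sum_j d i j n x i j = Phi (un d).
  by rewrite -psi_un; apply: eq_bigr => i _; apply: eq_bigr => j _; rewrite -xP.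
have pd : os_pos (map_mx phi d) by rewrite (map_mxcomp phi); exact: os_pos_comp.
have hd := os_pos_herm pd.
have Td : os_pos (T d) by rewrite TE hd; exact: os_posD.
(* Only [phi d], not [d], is known to be self-adjoint; this already makes [T] vanish on purely
   imaginary multiples of [d], so [Phi (un d)] is real. *)
have Tim (c : C) : c^*%R = - c -> 0 <= F (c *: un d).
  move=> cc; rewrite -unZ; apply: Fpos.
  have -> : T (map_mx ( *:%R c) d) = 0; last exact: os_pos0.
  rewrite TE; apply/matrixP => i j; have /matrixP/(_ i j) := hd.
  rewrite !mxE => qE; rewrite !phiZ os_starZ cc scaleNr qE; exact: subrr.
have Fi : F ('i%C *: un d) = 0.
  have ci : ('i%C : C)^*%R = - 'i%C by rewrite complexiE conjCi.
  apply/eqP; rewrite eq_le Tim// andbT -oppr_ge0 -(real_linearN lF) -scaleNr.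
  by apply: Tim; rewrite rmorphN /= ci.
by rewrite PhiE Fi oppr0 ler0c; exact: Fpos.
Qed.


End StateExtension.

Theorem theorem7p4 (R : realType) (V W : tvsType R[i])
    (hV : hausdorff_space V) (hW : hausdorff_space W) (G : groupType)
    (K : mads V G) (L : mads W G) (f : cma_map L K)
    (feq : cma_equivariant f) (fsurj : cma_surjective f) :
  is_boundary f <-> is_essential (aff_extension feq fsurj).
Proof.
split; last exact: essential_boundary.
move=> bd Q phi phim emb; apply: (positivity_locus_full phim).
apply: (bd (positivity_cmcset phi)) => /=.
- exact: positivity_locus_sub.
- exact: positivity_locus_invariant.
move=> n; apply/seteqP; split=> // y _.
have [|x [px xy]] := @positive_preimage R V W hV G K L f fsurj Q phi phim.1 _ n y.
  move=> k c pc; apply/(emb.2.2 k c); congr os_pos: pc.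
  by apply/matrixP => i j; rewrite !mxE.
by exists x => //; apply/positivity_locusP.
Qed.
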